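(* Let $s\in\mathbb{N}$. Let $a_j,b_j,c_j>0$ and $d_j\ge1$ for $j=1,\dots,s$, and set $$\nu(\boldsymbol{x})=\exp\left(\sum_{j=1}^s c_j|x_j|^{d_j}\right),\qquad \omega(\boldsymbol{\xi})=\exp\left(\sum_{j=1}^s a_j|\xi_j|^{b_j}\right),\qquad\boldsymbol{x},\boldsymbol{\xi}\in\mathbb{R}^s.$$ Put $$B(s)=\sum_{j=1}^s\frac1{b_j},\quad D(s)=\sum_{j=1}^s\frac1{d_j},\quad C_j=\frac{c_j^{1/d_j}a_j^{1/b_j}}{2},\quad C_*=\inf_{1\le j\le s}C_j,\quad C_\sharp=\inf_{1\le j\le s}\left(\frac{C_*}{2}\right)^{d_j}.$$ For $N\in\mathbb{N}$ set $h_j=(a_jh)^{1/b_j}$ with $$h=N^{-\frac{1}{B(s)+D(s)}}\,C_\sharp^{-\frac{D(s)}{B(s)+D(s)}},$$ and define $n_j$, $j=1,\dots,s$, by $$n_j+1=\max\left\{\left\lfloor\frac{C_*}{C_j}\,C_\sharp^{\frac{1}{B(s)+D(s)}\left(\frac{D(s)}{b_j}-\frac{B(s)}{d_j}\right)}\,N^{\frac{1}{B(s)+D(s)}\left(\frac1{b_j}+\frac1{d_j}\right)}\right\rfloor,\,1\right\}.$$ Then, for all $N$ sufficiently large (with threshold depending only on $s$ and the parameters $a_j,b_j,c_j,d_j$), every $f\in E_s(\nu,\omega)$ satisfies $$|I(f)-Q_{\boldsymbol{h}}^{\mathscr{D}_{\boldsymbol{n}}}(f)|\le C(s)\,\exp\left(-N^{\frac{1}{B(s)+D(s)}}\,C_\sharp^{\frac{D(s)}{B(s)+D(s)}}\right)\|f\|,$$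 where $$C(s)=4\,s\prod_{j=1}^s\left(a_j^{1/b_j}+2\,\frac{\Gamma(1/d_j)}{d_j\,c_j^{1/d_j}}\right)+4\,\mathrm{e}\sum_{\emptyset\neq\mathfrak{u}\subseteq\{1,\dots,s\}}\ \prod_{j\in\mathfrak{u}}\frac{\Gamma(1/b_j)}{b_j},$$ and $N$ is an upper bound for the total number of function evaluations: $$(n_1+1)\cdots(n_s+1)\le N.$$
   Context: $\Gamma$ is the gamma function and $\mathrm{e}=\exp(1)$. Fourier transform: $\hat f(\boldsymbol{\xi})=\int_{\mathbb{R}^s}f(\boldsymbol{x})\,\mathrm{e}^{-2\pi\mathrm{i}\,\boldsymbol{\xi}\cdot\boldsymbol{x}}\,\mathrm{d}\boldsymbol{x}$. Function space: for $\nu,\omega:\mathbb{R}^s\to(0,\infty)$, $E_s(\nu,\omega)$ is the space of integrable functions $f:\mathbb{R}^s\to\mathbb{R}$ with $$\|f\|:=\|f\,\nu\|_{L^\infty(\mathbb{R}^s)}+\|\hat f\,\omega\|_{L^\infty(\mathbb{R}^s)}<\infty.$$ Since point values of $f$ are used, $f$ is understood to be continuous (i.e. identified with its continuous representative). Integral: $I(f)=\int_{\mathbb{R}^s}f(\boldsymbol{x})\,\mathrm{d}\boldsymbol{x}$. Truncated trapezoidal rule: for mesh sizes $\boldsymbol{h}=(h_1,\dots,h_s)$ with $h_j>0$ and $\boldsymbol{n}=(n_1,\dots,n_s)$ with nonnegative integers $n_j$, $$Q_{\boldsymbol{h}}^{\mathscr{D}_{\boldsymbol{n}}}(f)=h_1\cdots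 h_s\sum_{\boldsymbol{k}\in\mathscr{D}_{\boldsymbol{n}}}f(k_1h_1,\dots,k_sh_s),$$ where $\mathscr{D}_{\boldsymbol{n}}=\{\boldsymbol{k}\in\mathbb{Z}^s:\ -n_j/2\le k_j\le n_j/2\text{ for all }j=1,\dots,s\}$. *)

(* Defs.v *)
From HB Require Import structures.
From mathcomp Require Import all_boot all_order all_algebra.
From mathcomp Require Import all_classical all_reals all_analysis.
From mathcomp Require Import complex.
Set Implicit Arguments.
Unset Strict Implicit.
Unset Printing Implicit Defensive.
Import Order.TTheory GRing.Theory Num.Theory.
Import numFieldTopology.Exports numFieldNormedType.Exports.
Local Open Scope classical_set_scope.
Local Open Scope ring_scope.

(* The sigma-algebra on R^n generated by the coordinate maps (the same
   construction as the library's measurable structure on [n.-tuple R]); it is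
   the Borel sigma-algebra of R^n. *)
Section measurable_rV.
Context {R : realType} (n : nat).

Let coors : 'I_n -> 'rV[R]_n -> R := fun i x => x 0 i.

Let rV_set0 : g_sigma_preimage coors set0.
Proof. exact: sigma_algebra0. Qed.

Let rV_setC A : g_sigma_preimage coors A -> g_sigma_preimage coors (~` A).
Proof. exact: sigma_algebraC. Qed.

Let rV_bigcup (F : _^nat) : (forall i, g_sigma_preimage coors (F i)) ->
  g_sigma_preimage coors (\bigcup_i (F i)).
Proof. exact: sigma_algebra_bigcup. Qed.

HB.instance Definition _ :=
  @isMeasurable.Build (measure_tuple_display default_measure_display)
    'rV[R]_n (g_sigma_preimage coors) rV_set0 rV_setC rV_bigcup.

End measurable_rV.

Lemma measurable_fun_rVP {d1} {T1 : measurableType d1} {R : realType} n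
    (f : T1 -> 'rV[R]_n) :
  measurable_fun [set: T1] f <->
  forall i, measurable_fun [set: T1] (fun x => f x 0 i).
Proof.
have meas_preim : measurable_fun [set: T1] f <->
    g_sigma_preimage (fun i => (fun v : 'rV[R]_n => v 0 i) \o f)
      `<=` measurable.
  rewrite g_sigma_preimage_comp; split => [mf A [/= C preC <-]|prefS].
    exact: mf.
  by move=> _ A mA; apply: prefS; exists A.
apply: (iff_trans meas_preim); split => [fS i _ A mA|mf].
- apply: fS; apply: sub_sigma_algebra.
  rewrite -bigcup_seq/=; exists i => /=; first by rewrite mem_index_enum.
  by exists A.
- apply: smallest_sub; first exact: sigma_algebra_measurable.
  rewrite -bigcup_seq/=; apply: bigcup_sub => i _.
  by move=> A [B mB <-]; exact: mf.
Qed.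

Lemma measurable_rV_coord {R : realType} n (i : 'I_n) :
  measurable_fun [set: 'rV[R]_n] (fun v : 'rV[R]_n => v 0 i).
Proof. exact: (proj1 (measurable_fun_rVP idfun) (@measurable_id _ _ _) i). Qed.

Section lebesgue_rV.
Context {R : realType}.

Definition cons_rV n (p : measurableTypeR R * 'rV[R]_n) : 'rV[R]_n.+1 :=
  row_mx (const_mx p.1 : 'rV_1) p.2.

Definition uncons_rV n (v : 'rV[R]_n.+1) : measurableTypeR R * 'rV[R]_n :=
  (v 0 ord0, \row_j v 0 (lift ord0 j)).

Lemma uncons_rVK n : cancel (@uncons_rV n) (@cons_rV n).
Proof.
move=> v; apply/rowP => i; rewrite /cons_rV /uncons_rV /= mxE.
case: splitP => j ij; rewrite mxE; congr (v 0 _); apply/val_inj => /=.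
  by rewrite ij; case: j {ij} => -[].
by rewrite ij.
Qed.

Lemma cons_rVK n : cancel (@cons_rV n) (@uncons_rV n).
Proof.
case=> x v; rewrite /uncons_rV /cons_rV /=; congr (_, _).
  rewrite mxE; by case: splitP => // j _; rewrite mxE.
apply/rowP => j; rewrite !mxE; case: splitP => k /= ik.
  by have := ltn_ord k; rewrite -ik /bump.
by congr (v 0 _); apply/val_inj; case: ik.
Qed.

Lemma measurable_cons_rV n : measurable_fun [set: measurableTypeR R * 'rV[R]_n] (@cons_rV n).
Proof.
apply/measurable_fun_rVP => i; rewrite /cons_rV.
under eq_fun do rewrite mxE.
case: (@splitP 1 n i) => j ij.
  by under eq_fun do rewrite mxE; exact: measurable_fst.
exact: measurableT_comp (measurable_rV_coord j) (@measurable_snd _ _ _ _).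
Qed.

Lemma measurable_uncons_rV n : measurable_fun [set: 'rV[R]_n.+1] (@uncons_rV n).
Proof.
apply/measurable_fun_pair => /=; first exact: measurable_rV_coord.
apply/measurable_fun_rVP => j; under eq_fun do rewrite mxE.
exact: measurable_rV_coord.
Qed.

Section step.
Variables (n : nat) (mu : {sigma_finite_measure set 'rV[R]_n -> \bar R}).

Let prod_measure : {measure set (measurableTypeR R * 'rV[R]_n)%type -> \bar R} :=
  (@lebesgue_measure R \x mu)%E.

Definition cons_measure : set 'rV[R]_n.+1 -> \bar R :=
  pushforward (@lebesgue_measure R \x mu)%E (@cons_rV n).

Let cons_measure0 : cons_measure set0 = 0%E.
Proof.
by rewrite /cons_measure /pushforward preimage_set0 (measure0 prod_measure).
Qed.

Let cons_measure_ge0 A : (0 <= cons_measure A)%E.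
Proof. exact: (measure_ge0 prod_measure). Qed.

Let cons_measure_sigma_additive : semi_sigma_additive cons_measure.
Proof.
move=> F mF tF mUF; rewrite /cons_measure /pushforward preimage_bigcup.
apply: (@measure_semi_sigma_additive _ _ _ prod_measure).
- by move=> k; rewrite -[X in measurable X]setTI; exact: measurable_cons_rV.
- by move=> i j _ _ [p [Fi Fj]]; apply: tF => //; exists (cons_rV p).
- rewrite -preimage_bigcup -[X in measurable X]setTI.
  exact: measurable_cons_rV.
Qed.

HB.instance Definition _ := isMeasure.Build _ _ _ cons_measure
  cons_measure0 cons_measure_ge0 cons_measure_sigma_additive.

Let cons_measure_sigma_finite : sigma_finite setT cons_measure.
Proof.
have /sigma_finiteP[F [TF ndF Foo]] := sigma_finiteT (@lebesgue_measure R).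
have /sigma_finiteP[G [TG ndG Goo]] := sigma_finiteT mu.
exists (fun k => @uncons_rV n @^-1` (F k `*` G k)).
  rewrite -preimage_bigcup (_ : \bigcup_k (F k `*` G k) = setT).
    by rewrite preimage_setT.
  rewrite -subTset => -[x v] _; have : setT x by []; have : setT v by [].
  rewrite TF TG => -[k _ Gkv] [i _ Fix]; exists (maxn i k) => //; split.
    by move: Fix; exact/subsetPset/ndF/leq_maxl.
  by move: Gkv; exact/subsetPset/ndG/leq_maxr.
move=> k; have [mF Fk] := Foo k; have [mG Gk] := Goo k; split.
  rewrite -[X in measurable X]setTI; apply: measurable_uncons_rV => //.
  exact: measurableX.
rewrite (_ : cons_measure _ = (@lebesgue_measure R \x mu)%E (F k `*` G k)).
  by rewrite product_measure1E// lte_mul_pinfty// ge0_fin_numE.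
rewrite /cons_measure /pushforward; congr (_ _).
by apply/funext => p; rewrite /preimage /mkset cons_rVK.
Qed.

HB.instance Definition _ := @Measure_isSigmaFinite.Build _ _ _
  cons_measure cons_measure_sigma_finite.

End step.

(* The n-fold product of [lebesgue_measure]: see [lebesgue_rV_box]. *)
Fixpoint lebesgue_rV n : {sigma_finite_measure set 'rV[R]_n -> \bar R} :=
  match n with
  | 0%N => @dirac _ 'rV[R]_0 0 R
  | m.+1 => cons_measure (lebesgue_rV m)
  end.

End lebesgue_rV.

Lemma lebesgue_rV_box (R : realType) n (A : 'I_n -> set (measurableTypeR R)) :
  (forall i, measurable (A i)) ->
  lebesgue_rV n [set v : 'rV[R]_n | forall i, A i (v 0 i)] =
  (\prod_(i < n) @lebesgue_measure R (A i))%E.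
Proof.
elim: n A => [|n IH] A mA.
  rewrite big_ord0 /= diracE mem_set//= => -[].
  by move => [].
rewrite big_ord_recl -IH; last by move=> i; exact: mA.
rewrite -product_measure1E//; last first.
  rewrite (_ : [set _ | _] = \bigcap_(i in [set: 'I_n])
     ((fun v : 'rV[R]_n => v 0 i) @^-1` A (lift ord0 i))).
    apply: fin_bigcap_measurable => // i _.
    rewrite -[X in measurable X]setTI; apply: measurable_rV_coord => //; exact: mA.
  by apply/seteqP; split => v /= h => [i _|i]; [exact: h|exact: h].
rewrite /= /cons_measure /pushforward; congr (product_measure1 _ _ _).
apply/seteqP; split => -[x v] /=; rewrite /cons_rV /=.
  move=> h; split.
    by have := h ord0; rewrite mxE; case: splitP => // j _; rewrite mxE.
  move=> i; have := h (lift ord0 i); rewrite mxE; case: splitP => [j|j] /=.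
    by move=> e; have := ltn_ord j; rewrite -e.
  by move=> [e]; rewrite (_ : i = j)//; apply/val_inj.
move=> [hx hv] i; rewrite mxE; case: splitP => j ij.
  by rewrite mxE (_ : i = ord0)//; apply/val_inj => /=; rewrite ij; case: j {ij} => -[].
by rewrite (_ : i = lift ord0 j) //; apply/val_inj.
Qed.

Section function_space.
Context {R : realType} {s : nat}.
Implicit Types (f nu omega : 'rV[R]_s -> R) (x xi : 'rV[R]_s).

Definition dot xi x : R := \sum_(j < s) xi 0 j * x 0 j.

(* [exp (i t)] *)
Definition cis (t : R) : R[i] := (cos t +i* sin t)%C.

Definition Cintegral (g : 'rV[R]_s -> R[i]) : R[i] :=
  (Rintegral (lebesgue_rV s) setT (fun x => complex.Re (g x))
   +i* Rintegral (lebesgue_rV s) setT (fun x => complex.Im (g x)))%C.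

Definition fourier f xi : R[i] :=
  Cintegral (fun x => (f x)%:C%C * cis (- (2 * pi * dot xi x))).

Definition E_norm nu omega f : \bar R :=
  (Lnorm (lebesgue_rV s) +oo (fun x => (f x * nu x)%:E) +
   Lnorm (lebesgue_rV s) +oo
     (fun xi => (Normc.normc (fourier f xi) * omega xi)%:E))%E.

(* Elements of E_s(nu, omega) are identified with their continuous
   representatives. *)
Definition E_space nu omega : set ('rV[R]_s -> R) :=
  [set f : 'rV[R]_s -> R |
          [/\ continuous f,
              (lebesgue_rV s).-integrable setT (EFin \o f)
            & (E_norm nu omega f < +oo)%E]].

Definition Iint f : R := Rintegral (lebesgue_rV s) setT f.

Definition grid (n : 'I_s -> nat) : set 'rV[int]_s :=
  [set k : 'rV[int]_s |
     forall j, - ((n j)%:Q / 2) <= (k 0 j)%:Q <= (n j)%:Q / 2].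

Definition Qrule (h : 'I_s -> R) (n : 'I_s -> nat) f : R :=
  (\prod_(j < s) h j) *
  \sum_(k \in grid n) f (\row_j ((k 0 j)%:~R * h j)).

End function_space.

Section parameters.
Context {R : realType} {s : nat}.
Variables a b c d : 'I_s -> R.

(* nu is [expweight c d] and omega is [expweight a b]. *)
Definition expweight (u p : 'I_s -> R) (x : 'rV[R]_s) : R :=
  expR (\sum_(j < s) u j * (`|x 0 j| `^ p j)).

(* [suminv b] is B(s) and [suminv d] is D(s). *)
Definition suminv (p : 'I_s -> R) : R := \sum_(j < s) (p j)^-1.

Definition Cc (j : 'I_s) : R := c j `^ (d j)^-1 * a j `^ (b j)^-1 / 2.

Definition Cstar : R := inf (range Cc).

Definition Csharp : R := inf (range (fun j => (Cstar / 2) `^ d j)).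

Definition hpar (N : nat) : R :=
  N%:R `^ (- (suminv b + suminv d)^-1) *
  Csharp `^ (- (suminv d / (suminv b + suminv d))).

Definition mesh (N : nat) (j : 'I_s) : R := (a j * hpar N) `^ (b j)^-1.

Definition npoints (N : nat) (j : 'I_s) : R :=
  Cstar / Cc j *
  Csharp `^ ((suminv b + suminv d)^-1 * (suminv d / b j - suminv b / d j)) *
  N%:R `^ ((suminv b + suminv d)^-1 * ((b j)^-1 + (d j)^-1)).

End parameters.

(* Euler's integral, convergent for [0 < z]. *)
Definition Gammaf {R : realType} (z : R) : R :=
  Rintegral (@lebesgue_measure R) `]0, +oo[ (fun t => t `^ (z - 1) * expR (- t)).

Definition Cs {R : realType} {s : nat} (a b c d : 'I_s -> R) : R :=
  4 * s%:R *
    \prod_(j < s) (a j `^ (b j)^-1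
                   + 2 * (Gammaf (d j)^-1 / (d j * c j `^ (d j)^-1)))
  + 4 * expR 1 *
    \sum_(u : {set 'I_s} | u != finset.set0)
      \prod_(j in u) (Gammaf (b j)^-1 / b j).

(* Main.v *)
Require Import Defs.
From mathcomp Require Import finmap.
From mathcomp Require Import all_boot all_order all_algebra.
From mathcomp Require Import all_classical all_reals all_analysis.
From mathcomp Require Import measurable_realfun ess_sup_inf complex ring lra zify.
Import Order.TTheory GRing.Theory Num.Theory.
Import numFieldTopology.Exports numFieldNormedType.Exports.
Local Open Scope classical_set_scope.
Local Open Scope ring_scope.

(** The error is estimated without a Poisson summation formula for [f].  Let [K] be
the product of the one-dimensional Fejer kernels of period [h_j], normalized to
have mean value 1.  It is a trigonometric polynomial with constant term 1 and
coefficients in [0, 1], so the integral of [f K] is a weighted sum of values of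
the Fourier transform of [f] at the points of the dual lattice, and differs from
the integral of [f] by at most the sum of [|f^|] over the nonzero ones.  On the
other hand [K] is nonnegative, has integral [h_1 ... h_s] over each cell of the
mesh, and concentrates at the lattice points as its degree grows: the integral of
[f K] over the cells of the grid tends to the trapezoidal sum, and its integral
over the remaining cells is at most what the decay of [f] allows.

Both tails are sums of [exp (- c (k h)^p)] over [k], compared with Euler's
integral.  With [1 / hpar] as large parameter, the aliasing sum is [exp (- 1 / hpar)]
up to constants, and the box is so large that [c_j X_j^d_j >= 1 / hpar] at its
faces [x_j = X_j]; the constant [C_sharp] leaves a factor 2 in [X_j] to spare for
the rounding of [n_j].  The terms [3 h_j] (instead of [h_j]) coming from the crude
treatment of the cells are absorbed by taking [N] large. *)

(** * The Fejer kernel *)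

(* The Fejer kernel of period [h] and mean value 1, kept as a sum over pairs of
   frequencies so that its Fourier coefficients need not be collected. *)
Definition fejer {R : realType} (h : R) (M : nat) (x : R) : R :=
  M%:R^-1 * \sum_(pq : 'I_M * 'I_M)
    cos (2 * pi * (((pq.1)%:R - (pq.2)%:R) / h * x)).

(** The cosine of a difference separates [p] from [q]: the double sum is the squared modulus of a
    geometric sum of unit complex numbers, whence positivity. *)
Lemma fejer_square (R : realType) (h : R) M x : fejer h M x = M%:R^-1 *
  ((\sum_(p < M) cos (p%:R * (2 * pi * (x / h)))) ^+ 2 +
   (\sum_(p < M) sin (p%:R * (2 * pi * (x / h)))) ^+ 2).
Proof.
congr (_ * _); rewrite !expr2 !big_distrlr /= -big_split /=.
rewrite -(pair_big xpredT xpredT (fun p q : 'I_M =>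
  cos (2 * pi * ((p%:R - q%:R) / h * x)))) /=.
apply: eq_bigr => p _; rewrite -big_split /=; apply: eq_bigr => q _.
by rewrite -cosB; congr cos; ring.
Qed.

Lemma fejer_ge0 (R : realType) (h : R) M x : 0 <= fejer h M x.
Proof. by rewrite fejer_square mulr_ge0 ?invr_ge0 ?addr_ge0 ?sqr_ge0. Qed.

Lemma fejer_le (R : realType) (h : R) M x : fejer h M x <= M%:R.
Proof.
case: M => [|M]; first by rewrite /fejer invr0 mul0r.
rewrite /fejer ler_pdivrMl ?ltr0n//.
apply: (@le_trans _ _ (\sum_(pq : 'I_M.+1 * 'I_M.+1) 1)).
  by apply: ler_sum => pq _; exact: cos_le1.
by rewrite sumr_const card_prod card_ord -natrM.
Qed.

(* [(1 - z) * \sum_(p < M) z ^ p = 1 - z ^ M] for [z = exp (i t)], in real and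
   imaginary parts. *)
Lemma dirichlet_cos (R : realType) M (t : R) :
  (1 - cos t) * (\sum_(p < M) cos (p%:R * t)) +
    sin t * (\sum_(p < M) sin (p%:R * t)) = 1 - cos (M%:R * t).
Proof.
elim: M => [|M IH]; first by rewrite !big_ord0 mul0r cos0 !mulr0 addr0 subrr.
have eM : M.+1%:R * t = M%:R * t + t by rewrite -natr1 mulrDl mul1r.
rewrite !big_ord_recr /= eM cosD.
move: IH; lra.
Qed.

Lemma dirichlet_sin (R : realType) M (t : R) :
  (1 - cos t) * (\sum_(p < M) sin (p%:R * t)) -
    sin t * (\sum_(p < M) cos (p%:R * t)) = - sin (M%:R * t).
Proof.
elim: M => [|M IH]; first by rewrite !big_ord0 mul0r sin0 !mulr0 subrr oppr0.
have eM : M.+1%:R * t = M%:R * t + t by rewrite -natr1 mulrDl mul1r.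
rewrite !big_ord_recr /= eM sinD.
move: IH; lra.
Qed.

(** The two Dirichlet identities are squared and added: the left sides give
    [|1 - z|^2 = 2 (1 - cos t)] times the squared modulus of the sum, the right sides
    [|1 - z^M|^2 <= 4]. Away from the lattice points the kernel is thus [O(1 / M)]. *)
Lemma fejer_decay (R : realType) (h : R) M x : (0 < M)%N ->
  (1 - cos (2 * pi * (x / h))) * fejer h M x <= 2 / M%:R.
Proof.
move=> M0; rewrite fejer_square; set t := 2 * pi * (x / h).
have := dirichlet_cos R M t; have := dirichlet_sin R M t.
set C := \sum_(p < M) cos _; set S := \sum_(p < M) sin _ => eS eC.
have c2 := cos2Dsin2 t; have d2 := cos2Dsin2 (M%:R * t).
have cM := cos_geN1 (M%:R * t).
rewrite mulrCA mulrC ler_pM2r ?invr_gt0 ?ltr0n//.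
have : ((1 - cos t) * C + sin t * S) ^+ 2 + ((1 - cos t) * S - sin t * C) ^+ 2
  = 2 * ((1 - cos t) * (C ^+ 2 + S ^+ 2)).
  transitivity ((1 - 2 * cos t + (cos t ^+ 2 + sin t ^+ 2)) * (C ^+ 2 + S ^+ 2)).
    by ring.
  by rewrite c2; ring.
rewrite eC eS => e; rewrite -(ler_pM2l (ltr0n _ 2)) -e.
have -> : (1 - cos (M%:R * t)) ^+ 2 + (- sin (M%:R * t)) ^+ 2 =
  1 - 2 * cos (M%:R * t) + (cos (M%:R * t) ^+ 2 + sin (M%:R * t) ^+ 2) by ring.
rewrite d2; lra.
Qed.

Lemma continuous_cos_scale (R : realType) (a : R) :
  continuous (fun x : R => cos (2 * pi * (a * x))).
Proof.
move=> x; apply: (@continuous_comp _ _ _ (fun x => 2 * pi * (a * x)) cos).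
  by apply: cvgMr; apply: cvgMr; exact: cvg_id.
exact: continuous_cos.
Qed.

Lemma continuous_fejer (R : realType) (h : R) M : continuous (fejer h M).
Proof.
move=> x; apply: cvgMr; apply: cvg_big => [|pq _]; first exact: add_continuous.
exact: continuous_cos_scale.
Qed.

Lemma measurable_fejer (R : realType) (h : R) M :
  measurable_fun setT (fejer h M).
Proof. exact: continuous_measurable_fun (continuous_fejer R h M). Qed.

Lemma integral_itv_is_derive (R : realType) (f F : R -> R) (a b : R) : a < b ->
  continuous f -> (forall x : R, is_derive x 1 F (f x)) ->
  (\int[@lebesgue_measure R]_(x in `[a, b]) (f x)%:E = (F b - F a)%:E)%E.
Proof.
move=> ab cf dF.
have cF : continuous F.
  by move=> x; apply: differentiable_continuous; apply/derivable1_diffP; exact: ex_derive.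
rewrite (@continuous_FTC2 _ f F a b ab) //.
- exact: continuous_subspaceT.
- split => [x _||]; first exact: ex_derive.
    by apply: cvg_at_right_filter; exact: cF.
  by apply: cvg_at_left_filter; exact: cF.
- by move=> x _; rewrite derive1E derive_val.
Qed.

Lemma sinDn2pi (R : realType) (p q : nat) (x : R) :
  sin (x + 2 * pi * (p%:R - q%:R)) = sin x.
Proof.
have E n : (pi *+ 2 *+ n : R) = 2 * pi * n%:R.
  by rewrite -[in LHS]mulr_natr -[pi *+ 2]mulr_natl.
rewrite -[in RHS](periodicn (@sinD2pi R) p) -[in LHS](periodicn (@sinD2pi R) q).
by rewrite !E; congr sin; ring.
Qed.

Lemma is_derive_sin_scale (R : realType) (w x : R) :
  is_derive x 1 (fun x : R => sin (w * x)) (w * cos (w * x)).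
Proof.
have d1 : is_derive x (1 : R) (w \*: id) (w *: 1) by exact: is_deriveZ.
apply: (@is_derive_eq _ _ _ _ _ _ _ _ (is_derive1_comp (is_derive_sin ((w \*: id) x)) d1)).
by rewrite [w *: 1]mulr1 mulrC.
Qed.

Lemma integral_cos_period (R : realType) (h y : R) (p q : nat) : 0 < h ->
  (\int[@lebesgue_measure R]_(x in `[y, (y + h)%R])
     (cos (2 * pi * ((p%:R - q%:R) / h * x)))%:E =
   (if p == q then h else 0)%:E)%E.
Proof.
move=> h0; have yh : y < y + h by rewrite ltrDl.
case: eqVneq => [->|pq].
  have d (x : R) : is_derive x 1 id (cos (2 * pi * ((q%:R - q%:R) / h * x))).
    by apply: is_derive_eq; rewrite subrr mul0r mul0r mulr0 cos0.
  rewrite (integral_itv_is_derive _ _ id _ _ yh (continuous_cos_scale _ _) d).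
  by rewrite addrC addKr.
have k0 : (p%:R - q%:R : R) != 0 by rewrite subr_eq0 eqr_nat.
pose w : R := 2 * pi * (p%:R - q%:R) / h.
have w0 : w != 0 by rewrite !mulf_neq0 ?invr_eq0// ?gt_eqF// ?pi_gt0.
have d (x : R) : is_derive x 1 (fun x => w^-1 * sin (w * x))
    (cos (2 * pi * ((p%:R - q%:R) / h * x))).
  apply: (@is_derive_eq _ _ _ _ _ _ _ _ (is_deriveZ w^-1 (is_derive_sin_scale R w x))).
  rewrite [_ *: _]mulKf//.
  by congr cos; rewrite /w; field; rewrite gt_eqF.
rewrite (integral_itv_is_derive _ _ _ _ _ yh (continuous_cos_scale _ _) d).
have -> : w * (y + h) = w * y + 2 * pi * (p%:R - q%:R).
  by rewrite /w; field; rewrite gt_eqF.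
by rewrite sinDn2pi subrr.
Qed.

(** By orthogonality only the [M] diagonal pairs survive, each contributing [h]; the mass of a
    period is therefore independent of the degree. *)
Lemma integral_fejer_period (R : realType) (h y : R) M : 0 < h -> (0 < M)%N ->
  (\int[@lebesgue_measure R]_(x in `[y, (y + h)%R]) (fejer h M x)%:E = h%:E)%E.
Proof.
move=> h0 M0.
have ic (pq : 'I_M * 'I_M) : (@lebesgue_measure R).-integrable `[y, (y + h)%R]
    (EFin \o (fun x => cos (2 * pi * ((pq.1%:R - pq.2%:R) / h * x)))).
  apply: continuous_compact_integrable; first exact: segment_compact.
  apply: continuous_subspaceT; exact: continuous_cos_scale.
under eq_integral do rewrite /fejer EFinM -sumEFin.
rewrite integralZl//; last by apply: integrable_sum => // pq _; exact: ic.
rewrite integral_sum//.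
under eq_bigr do rewrite integral_cos_period//.
rewrite sumEFin -EFinM; congr _%:E.
rewrite -(pair_big xpredT xpredT (fun p q : 'I_M =>
  if (p : nat) == q then h else 0)) /=.
under eq_bigr => p _.
  rewrite (bigD1 p)//= eqxx big1 ?addr0; last first.
    by move=> q; rewrite eq_sym -val_eqE /= => /negbTE ->.
  over.
rewrite sumr_const card_ord -[h *+ M]mulr_natl mulrA mulVf ?mul1r//.
by rewrite pnatr_eq0 -lt0n.
Qed.

(** * Integrals of products and the Fourier transform *)

Lemma measurable_prod_rV (R : realType) n (F : 'I_n -> R -> R) :
  (forall i, measurable_fun setT (F i)) ->
  measurable_fun setT (fun v : 'rV[R]_n => \prod_i F i (v 0 i)).
Proof.
move=> mF; apply: measurable_prod => i _.
exact: measurableT_comp (mF i) (measurable_rV_coord i).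
Qed.

Lemma cons_rV0 (R : realType) n (p : measurableTypeR R * 'rV[R]_n) :
  cons_rV p 0 ord0 = p.1.
Proof. by rewrite -[in RHS](cons_rVK p). Qed.

Lemma cons_rVS (R : realType) n (p : measurableTypeR R * 'rV[R]_n) i :
  cons_rV p 0 (lift ord0 i) = p.2 0 i.
Proof. by rewrite -[in RHS](cons_rVK p) /uncons_rV /= mxE. Qed.

(** Induction on the dimension: the measure is a pushforward under [cons_rV], and Tonelli splits off
    the first coordinate. In dimension 0 it is a Dirac mass. *)
Lemma ge0_integral_prod_rV (R : realType) n (F : 'I_n -> R -> R) :
  (forall i, measurable_fun setT (F i)) -> (forall i x, 0 <= F i x) ->
  (\int[lebesgue_rV n]_v (\prod_i F i (v 0 i))%:E =
   \prod_i \int[@lebesgue_measure R]_x (F i x)%:E)%E.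
Proof.
elim: n F => [|n IH] F mF F0.
  rewrite big_ord0 [LHS]integral_dirac//; first by rewrite diracT mul1e big_ord0.
  by apply/measurable_EFinP; exact: measurable_prod_rV.
have mG : measurable_fun setT (fun v : 'rV[R]_n.+1 => (\prod_i F i (v 0 i))%:E).
  by apply/measurable_EFinP; exact: measurable_prod_rV.
rewrite [LHS](ge0_integral_pushforward (@measurable_cons_rV R n) _ _ mG)//; last first.
  by move=> v _; rewrite lee_fin prodr_ge0.
rewrite preimage_setT fubini_tonelli1 /fubini_F /=; last 2 first.
- by apply: measurableT_comp mG _; exact: measurable_cons_rV.
- by move=> v; rewrite lee_fin prodr_ge0.
rewrite big_ord_recl -IH//.
transitivity (\int[@lebesgue_measure R]_x ((F ord0 x)%:E *
  \int[lebesgue_rV n]_v (\prod_i F (lift ord0 i) (v 0 i))%:E))%E; last first.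
  rewrite ge0_integralZr//.
  - by apply/measurable_EFinP; exact: mF.
  - by move=> x _; rewrite lee_fin.
  - by apply: integral_ge0 => v _; rewrite lee_fin prodr_ge0.
apply: eq_integral => x _; rewrite -ge0_integralZl//.
- apply: eq_integral => v _; rewrite big_ord_recl cons_rV0 EFinM.
  by congr (_ * _%:E)%E; apply: eq_bigr => i _; rewrite cons_rVS.
- by apply/measurable_EFinP; apply: (measurable_prod_rV R n (fun i => F (lift ord0 i))).
- by move=> v _; rewrite lee_fin prodr_ge0.
- by rewrite lee_fin.
Qed.

Lemma cisD (R : realType) (t u : R) : cis (t + u) = cis t * cis u.
Proof.
rewrite /cis cosD sinD; apply/eqP; rewrite eq_complex /=.
by apply/andP; split; apply/eqP; ring.
Qed.

Lemma cis_sum (R : realType) (I : Type) (r : seq I) (t : I -> R) :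
  cis (\sum_(i <- r) t i) = \prod_(i <- r) cis (t i).
Proof.
apply: (big_morph cis); first exact: cisD.
by rewrite /cis cos0 sin0.
Qed.

Lemma sum_cisE (R : realType) (I : Type) (r : seq I) (t : I -> R) :
  \sum_(i <- r) cis (t i) =
  ((\sum_(i <- r) cos (t i)) +i* (\sum_(i <- r) sin (t i)))%C.
Proof.
elim: r => [|i r IH]; first by rewrite !big_nil.
by rewrite !big_cons IH; apply/eqP; rewrite eq_complex /= !eqxx.
Qed.

(** Vanishing sine sums make each exponential sum real, so the product of cosine sums is a product
    of exponential sums, whose expansion has one cosine per choice function and no mixed
    products. *)
Lemma prod_sum_cos (R : realType) s (T : finType) (t : 'I_s -> T -> R) :
  (forall j, \sum_k sin (t j k) = 0) ->
  \prod_j \sum_k cos (t j k) = \sum_(P : {ffun 'I_s -> T}) cos (\sum_j t j (P j)).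
Proof.
move=> t0.
suff : (\prod_j \sum_k cis (t j k)) = \sum_(P : {ffun 'I_s -> T}) cis (\sum_j t j (P j)).
  rewrite sum_cisE => e.
  transitivity (complex.Re (\prod_j \sum_k cis (t j k))); last by rewrite e.
  under [in RHS]eq_bigr do rewrite sum_cisE t0.
  by rewrite -(rmorph_prod (real_complex R)).
by rewrite bigA_distr_bigA /=; apply: eq_bigr => P _; rewrite cis_sum.
Qed.

Lemma prod_fejer (R : realType) s (h : 'I_s -> R) M (x : 'rV[R]_s) :
  \prod_j fejer (h j) M (x 0 j) = M%:R ^- s *
  \sum_(P : {ffun 'I_s -> 'I_M * 'I_M})
     cos (2 * pi * dot (\row_j (((P j).1%:R - (P j).2%:R) / h j)) x).
Proof.
rewrite /fejer big_split /= prodr_const card_ord exprVn; congr (_ * _).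
rewrite prod_sum_cos.
  apply: eq_bigr => P _; congr cos; rewrite /dot mulr_sumr.
  by apply: eq_bigr => j _; rewrite mxE.
move=> j.
rewrite -(pair_big xpredT xpredT (fun p q : 'I_M =>
  sin (2 * pi * ((p%:R - q%:R) / h j * x 0 j)))) /=.
set S := \sum_(i < M) _.
(* Exchanging [p] and [q] negates every frequency, and the sine is odd. *)
suff e : S = - S by move: e; lra.
rewrite {1}/S exchange_big -sumrN; apply: eq_bigr => p _; rewrite -sumrN.
by apply: eq_bigr => q _; rewrite -sinN; congr sin; ring.
Qed.

Lemma Re_fourier (R : realType) s (f : 'rV[R]_s -> R) xi :
  complex.Re (fourier f xi) =
  Rintegral (lebesgue_rV s) setT (fun x => f x * cos (2 * pi * dot xi x)).
Proof.
by apply: eq_Rintegral => x _ /=; rewrite mul0r subr0 cosN.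
Qed.

Lemma measurable_cos_dot (R : realType) s (xi : 'rV[R]_s) :
  measurable_fun setT (fun x : 'rV[R]_s => cos (2 * pi * dot xi x)).
Proof.
apply: (@measurableT_comp _ _ _ _ _ _ (@cos R)).
  exact: continuous_measurable_fun (@continuous_cos R).
apply: measurable_funM => //; apply: measurable_sum => j.
by apply: measurable_funM => //; exact: measurable_rV_coord.
Qed.

Lemma integrable_mul_bounded (R : realType) d (T : measurableType d)
    (mu : {measure set T -> \bar R}) (f g : T -> R) (K : R) :
  mu.-integrable setT (EFin \o f) -> measurable_fun setT g ->
  (forall x, `|g x| <= K) -> mu.-integrable setT (EFin \o (fun x => f x * g x)).
Proof.
move=> fi mg gK.
have mf : measurable_fun setT f by apply/measurable_EFinP; exact: measurable_int fi.
apply: (@le_integrable _ _ _ mu _ measurableT _ (fun x => (K%:E * (EFin \o f) x)%E)).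
- by apply/measurable_EFinP; exact: measurable_funM.
- move=> x _ /=; rewrite lee_fin normrM normrM mulrC ler_wpM2r//.
  exact: le_trans (gK x) (ler_norm K).
- exact: integrableZl.
Qed.

Lemma Rintegral_sum (R : realType) d (T : measurableType d)
    (mu : {measure set T -> \bar R}) (I : Type) (r : seq I) (f : I -> T -> R) :
  (forall i, mu.-integrable setT (EFin \o f i)) ->
  Rintegral mu setT (fun x => \sum_(i <- r) f i x) =
  \sum_(i <- r) Rintegral mu setT (f i).
Proof.
move=> fi; rewrite /Rintegral.
under eq_integral do rewrite -sumEFin.
rewrite integral_sum//.
by rewrite sum_fine// => i _; apply: integrable_fin_num => //; exact: fi.
Qed.

(** A finite substitute for Poisson summation. Real parts of the transform suffice because the
    kernel is a sum of cosines. *)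
Lemma Rintegral_fejer (R : realType) s (h : 'I_s -> R) M (f : 'rV[R]_s -> R) :
  (lebesgue_rV s).-integrable setT (EFin \o f) ->
  Rintegral (lebesgue_rV s) setT (fun x => f x * \prod_j fejer (h j) M (x 0 j)) =
  M%:R ^- s * \sum_(P : {ffun 'I_s -> 'I_M * 'I_M})
     complex.Re (fourier f (\row_j (((P j).1%:R - (P j).2%:R) / h j))).
Proof.
move=> fi.
pose g (P : {ffun 'I_s -> 'I_M * 'I_M}) (x : 'rV[R]_s) :=
  f x * cos (2 * pi * dot (\row_j (((P j).1%:R - (P j).2%:R) / h j)) x).
have gi P : (lebesgue_rV s).-integrable setT (EFin \o g P).
  apply: (integrable_mul_bounded _ _ _ _ _ _ 1) => //; first exact: measurable_cos_dot.
  by move=> x; exact: cos_max.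
under [in RHS]eq_bigr do rewrite Re_fourier.
rewrite -(Rintegral_sum _ _ _ _ _ _ g)// -RintegralZl//.
  by apply: eq_Rintegral => x _; rewrite prod_fejer mulrCA mulr_sumr.
rewrite (_ : EFin \o _ = (fun x => \sum_(P : {ffun 'I_s -> 'I_M * 'I_M})
  (EFin \o g P) x)%E); last by apply/funext => x /=; rewrite sumEFin.
exact: integrable_sum.
Qed.

(** * Comparison with Euler's integral *)

Lemma continuous_at_is_derive (R : realType) (F : R -> R) (x df : R) :
  is_derive x 1 F df -> {for x, continuous F}.
Proof.
by move=> dF; apply: differentiable_continuous; apply/derivable1_diffP; exact: ex_derive.
Qed.

Lemma integral_powR_itv (R : realType) (z u v : R) : z != 0 -> 0 < u -> u < v ->
  (\int[@lebesgue_measure R]_(t in `[u, v]) (t `^ (z - 1))%:E =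
   ((v `^ z - u `^ z) / z)%:E)%E.
Proof.
move=> z0 u0 uv.
have dF (x : R) : 0 < x -> is_derive x 1 (fun x => z^-1 * x `^ z) (x `^ (z - 1)).
  move=> x0; have := is_deriveZ z^-1 (is_derive1_powR z x0).
  by rewrite [_ *: (_ : R)]mulKf.
have cF (x : R) : 0 < x -> {for x, continuous (fun x => z^-1 * x `^ z)}.
  by move=> x0; apply: continuous_at_is_derive; exact: dF.
rewrite (@continuous_FTC2 _ _ (fun x => z^-1 * x `^ z) _ _ uv).
- by rewrite -EFinB -mulrBr mulrC.
- apply: continuous_in_subspaceT => x; rewrite inE /= in_itv /= => /andP[ux _].
  by apply: continuous_at_is_derive; apply: is_derive1_powR; exact: lt_le_trans u0 ux.
- split.
  + move=> x; rewrite in_itv /= => /andP[ux _]; apply: ex_derive.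
    by apply: dF; exact: lt_trans ux.
  + by apply: cvg_at_right_filter; exact: cF.
  + by apply: cvg_at_left_filter; apply: cF; exact: lt_trans uv.
- move=> x; rewrite in_itv /= => /andP[ux _].
  by have [_ <-] := dF x (lt_trans u0 ux); rewrite derive1E.
Qed.

(** For [z < 1] the integrand is unbounded at 0, so the fundamental theorem is applied on [[u n, v]]
    and monotone convergence does the rest. *)
Lemma integral_powR_0 (R : realType) (z v : R) : 0 < z -> 0 < v ->
  (\int[@lebesgue_measure R]_(t in `]0%R, v]) (t `^ (z - 1))%:E = (v `^ z / z)%:E)%E.
Proof.
move=> z0 v0.
(* The denominator starts at 2, so that [u n < v] strictly already for [n = 0]. *)
pose u n := v / n.+2%:R.
have u0 n : 0 < u n by rewrite divr_gt0.
have uv n : u n < v by rewrite ltr_pdivrMr// ltr_pMr// ltr1n.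
have -> : `]0%R, v]%classic = \bigcup_n `[u n, v]%classic.
  apply/seteqP; split => [x /=|x [n _ /=]]; rewrite !in_itv /=; last first.
    by move=> /andP[ux ->]; rewrite (lt_le_trans (u0 n) ux).
  move=> /andP[x0 xv]; exists (Num.truncn (v / x)) => //=; rewrite in_itv /= xv andbT.
  rewrite ler_pdivrMr// -ler_pdivrMl// mulrC ltW//.
  apply: lt_le_trans (truncnS_gt _) _.
  by rewrite ler_nat.
have mp : measurable_fun setT (fun t : R => (t `^ (z - 1))%:E).
  by apply/measurable_EFinP; exact: measurable_powR.
have c : (\int[@lebesgue_measure R]_(t in `[u n, v]) (t `^ (z - 1))%:E @[n --> \oo] -->
    \int[@lebesgue_measure R]_(t in \bigcup_n `[u n, v]%classic) (t `^ (z - 1))%:E)%E.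
  apply: (@ge0_nondecreasing_set_cvg_integral _ (measurableTypeR R) _
    (fun n => `[u n, v]%classic) (fun t => (t `^ (z - 1))%:E) (@lebesgue_measure R)) => //.
  - apply/nondecreasing_seqP => n; rewrite subsetEset.
    apply: subset_itvr; rewrite bnd_simp.
    by rewrite ler_pM2l// lef_pV2 ?posrE// ler_nat.
  - by move=> n; exact: measurable_funTS.
  - by move=> n x _; rewrite lee_fin powR_ge0.
have d : (\int[@lebesgue_measure R]_(t in `[u n, v]) (t `^ (z - 1))%:E @[n --> \oo] -->
    (v `^ z / z)%:E)%E.
  rewrite (_ : (fun n => _) = (fun n => ((v `^ z - (u n) `^ z) / z)%:E)); last first.
    by apply/funext => n; rewrite integral_powR_itv ?gt_eqF.
  apply: cvg_EFin; first exact: nearW.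
  apply: cvgMl; rewrite -[X in _ --> X]subr0; apply: cvgB; first exact: cvg_cst.
  have /cvg_at_rightP := @powR_cvg0 R z z0; apply; split => //.
  rewrite -[X in _ --> X](mulr0 v); apply: cvgMr.
  have := @cvg_harmonic R; rewrite -cvg_shiftS; exact.
exact: (cvg_unique _ c d).
Qed.

(** From [t / (2 m) <= exp (t / (2 m))] follows [t^m <= (2 m)^m exp (t / 2)]; the remaining
    [exp (- t / 2)] is twice the exponential density of rate 1/2. *)
Lemma gamma_integrand_le (R : realType) (z t : R) : 1 <= t ->
  t `^ (z - 1) * expR (- t) <=
  (2 * Num.max z 1) `^ Num.max z 1 * 2 * exponential_pdf 2^-1 t.
Proof.
move=> t1; set m := Num.max z 1.
have t0 : 0 < t by exact: lt_le_trans ltr01 t1.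
have m1 : 1 <= m by rewrite /m le_max lexx orbT.
have m0 : 0 < m by exact: lt_le_trans ltr01 m1.
rewrite exponential_pdfE; last exact: ltW.
have -> : (2 * m) `^ m * 2 * (2^-1 * expR (- 2^-1 * t)) =
    (2 * m) `^ m * expR (t / 2) * expR (- t).
  by rewrite -[RHS]mulrA -expRD mulrA mulfK//; congr (_ * expR _); field.
rewrite ler_wpM2r ?expR_ge0//.
apply: (@le_trans _ _ (t `^ m)).
  by apply: ler_powR => //; rewrite (@le_trans _ _ z)// ?gerBl// /m le_max lexx.
have -> : expR (t / 2) = expR (t / (2 * m)) `^ m.
  by rewrite -expRM; congr expR; field; rewrite gt_eqF.
rewrite -powRM ?expR_ge0//; last by rewrite mulr_ge0// ltW.
apply: ge0_ler_powR; rewrite ?nnegrE ?mulr_ge0 ?expR_ge0 ?(ltW m0) ?(ltW t0)//.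
rewrite mulrC -ler_pdivrMr ?mulr_gt0//.
by apply: le_trans (expR_ge1Dx _); rewrite lerDr.
Qed.

Lemma measurable_gamma_integrand (R : realType) (z : R) :
  measurable_fun setT (fun t : R => (t `^ (z - 1) * expR (- t))%:E).
Proof.
apply/measurable_EFinP; apply: measurable_funM; first exact: measurable_powR.
apply: measurableT_comp => //; exact: measurable_expR.
Qed.

(** Finiteness matters because [Gammaf] takes a [fine] part, which would read an infinite integral
    as 0. The range is split at 1: below, [exp (- t) <= 1]; above, the exponential density
    dominates. *)
Lemma gamma_lty (R : realType) (z : R) : 0 < z ->
  (\int[@lebesgue_measure R]_(t in `]0%R, +oo[) (t `^ (z - 1) * expR (- t))%:E < +oo)%E.
Proof.
move=> z0.
have -> : `]0%R, +oo[%classic = (`]0%R, 1%R] `|` `]1%R, +oo[)%classic :> set R.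
  by rewrite -itv_bndbnd_setU// bnd_simp.
have mg := measurable_gamma_integrand R z.
have g0 (t : R) : (0 <= (t `^ (z - 1) * expR (- t))%:E)%E.
  by rewrite lee_fin mulr_ge0 ?powR_ge0 ?expR_ge0.
rewrite ge0_integral_setU//=; last 2 first.
- exact: measurable_funTS.
- rewrite disj_set2E; apply/eqP; rewrite -subset0 => x [] /=; rewrite !in_itv /=.
  by move=> /andP[_ +]; rewrite andbT; move=> /le_lt_trans /[apply]; rewrite ltxx.
apply: lte_add_pinfty.
  apply: (@le_lt_trans _ _ (\int[@lebesgue_measure R]_(t in `]0%R, 1%R]) (t `^ (z - 1))%:E)%E).
    apply: ge0_le_integral => //.
    - exact: measurable_funTS.
    - by apply: measurable_funTS; apply/measurable_EFinP; exact: measurable_powR.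
    - move=> t /=; rewrite in_itv /= => /andP[t0 _].
      by rewrite lee_fin ler_piMr ?powR_ge0// expR_le1 oppr_le0 ltW.
  by rewrite integral_powR_0// ltry.
set C : R := (2 * Num.max z 1) `^ Num.max z 1 * 2.
have C0 : 0 <= C by rewrite mulr_ge0 ?powR_ge0.
apply: (@le_lt_trans _ _ (\int[@lebesgue_measure R]_(t in `]1%R, +oo[)
   (C%:E * (exponential_pdf 2^-1 t)%:E))%E).
  apply: ge0_le_integral => //.
  - exact: measurable_funTS.
  - apply: measurable_funTS; apply: measurable_funeM; apply/measurable_EFinP.
    exact: measurable_exponential_pdf.
  - move=> t /=; rewrite in_itv /= andbT => t1.
    by rewrite -EFinM lee_fin; apply: gamma_integrand_le; exact: ltW.
apply: (@le_lt_trans _ _ (\int[@lebesgue_measure R]_t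
   (C%:E * (exponential_pdf 2^-1 t)%:E))%E).
  apply: ge0_subset_integral => //.
  - apply: measurable_funeM; apply/measurable_EFinP.
    exact: measurable_exponential_pdf.
  - by move=> t _; rewrite -EFinM lee_fin mulr_ge0 ?exponential_pdf_ge0.
rewrite ge0_integralZl_EFin//.
- by rewrite integral_exponential_pdf ?invr_gt0// mule1 ltry.
- by move=> t _; rewrite lee_fin exponential_pdf_ge0.
- by apply/measurable_EFinP; exact: measurable_exponential_pdf.
Qed.

Lemma integral_powR_oc (R : realType) (z u v : R) : 0 < z -> 0 <= u -> u < v ->
  (\int[@lebesgue_measure R]_(t in `]u, v]) (t `^ (z - 1))%:E =
   ((v `^ z - u `^ z) / z)%:E)%E.
Proof.
move=> z0; rewrite le_eqVlt => /predU1P[<- v0|u0 uv].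
  by rewrite powR0 ?gt_eqF// subr0 integral_powR_0.
rewrite -integral_powR_itv ?gt_eqF// integral_itv_obnd_cbnd//.
by apply: measurable_funTS; apply/measurable_EFinP; exact: measurable_powR.
Qed.

Lemma integral_oc_cat (R : realType) (f : R -> \bar R) (u : nat -> R) n :
  measurable_fun setT f -> (forall x, 0 <= f x)%E ->
  {homo u : i j / (i <= j)%N >-> i <= j} ->
  (\int[@lebesgue_measure R]_(t in `]u 0%N, u n]) f t =
   \sum_(k < n) \int[@lebesgue_measure R]_(t in `]u k, u k.+1]) f t)%E.
Proof.
move=> mf f0 ndu; elim: n => [|n IH]; first by rewrite set_itvxx ?big_ord0 ?integral_set0.
rewrite big_ord_recr /= -IH.
have -> : `]u 0%N, u n.+1]%classic = (`]u 0%N, u n] `|` `]u n, u n.+1])%classic :> set R.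
  by rewrite -itv_bndbnd_setU// bnd_simp ndu.
rewrite ge0_integral_setU//=.
- exact: measurable_funTS.
- rewrite disj_set2E; apply/eqP; rewrite -subset0 => x [] /=; rewrite !in_itv /=.
  by move=> /andP[_ +] /andP[+ _]; move=> /le_lt_trans /[apply]; rewrite ltxx.
Qed.

(* The substitution [t = c x^p] in Euler's integral, carried out on each interval
   between consecutive [c (k h)^p]: there [exp (- t)] is at least its value at the
   right end, so that only the integral of [t^(1/p - 1)] is needed. *)
Lemma sum_expR_powR_le_gamma (R : realType) (p c h : R) K : 0 < p -> 0 < c -> 0 < h ->
  h * \sum_(k < K) expR (- (c * (k.+1%:R * h) `^ p)) <=
  Gammaf p^-1 / (p * c `^ p^-1).
Proof.
move=> p0 c0 h0; rewrite ler_pdivlMr ?mulr_gt0 ?powR_gt0//.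
have z0 : 0 < p^-1 by rewrite invr_gt0.
set z := p^-1 in z0 *.
pose u (k : nat) : R := c * (k%:R * h) `^ p.
have ltu : {homo u : i j / (i < j)%N >-> i < j}.
  move=> i j ij; rewrite ltr_pM2l//.
  apply: gt0_ltr_powR; rewrite ?nnegrE ?mulr_ge0 ?(ltW h0)//.
  by rewrite ltr_pM2r// ltr_nat.
have ndu : {homo u : i j / (i <= j)%N >-> i <= j} by exact: ltW_homo.
have u0 : u 0%N = 0 by rewrite /u mul0r powR0 ?gt_eqF// mulr0.
(* The substitution at the partition points: their [z]-th powers are equally spaced, so every
   interval contributes the same increment. *)
have uz k : u k `^ z = c `^ z * (k%:R * h).
  rewrite powRM ?powR_ge0 ?(ltW c0)// -powRrM divff ?gt_eqF//.
  by rewrite powRr1// mulr_ge0// ltW.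
have mg := measurable_gamma_integrand R z.
have g0 (t : R) : (0 <= (t `^ (z - 1) * expR (- t))%:E)%E.
  by rewrite lee_fin mulr_ge0 ?powR_ge0 ?expR_ge0.
rewrite /Gammaf -lee_fin fineK; last first.
  by rewrite ge0_fin_numE ?gamma_lty// integral_ge0.
apply: (@le_trans _ _ (\int[@lebesgue_measure R]_(t in `]u 0%N, u K])
   (t `^ (z - 1) * expR (- t))%:E)%E); last first.
  apply: ge0_subset_integral => //; first exact: measurable_funTS.
  by rewrite u0 => x /=; rewrite !in_itv /= => /andP[->].
rewrite integral_oc_cat// mulr_sumr mulr_suml -sumEFin.
apply: lee_sum => k _.
apply: (@le_trans _ _ (\int[@lebesgue_measure R]_(t in `]u k, u k.+1])
   ((expR (- u k.+1))%:E * (t `^ (z - 1))%:E))%E); last first.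
  apply: ge0_le_integral => //.
  - by move=> t _; rewrite -EFinM lee_fin mulr_ge0 ?powR_ge0 ?expR_ge0.
  - apply: measurable_funTS; apply: measurable_funeM; apply/measurable_EFinP.
    exact: measurable_powR.
  - exact: measurable_funTS.
  - move=> t /=; rewrite in_itv /= => /andP[_ tu].
    by rewrite -EFinM lee_fin mulrC ler_wpM2l ?powR_ge0// ler_expR lerN2.
rewrite ge0_integralZl_EFin ?expR_ge0//; last 2 first.
- by move=> t _; rewrite lee_fin powR_ge0.
- by apply: measurable_funTS; apply/measurable_EFinP; exact: measurable_powR.
rewrite integral_powR_oc//; last 2 first.
- by rewrite -u0 ndu.
- exact: ltu.
rewrite -EFinM lee_fin !uz -natr1 /u -natr1 le_eqVlt; apply/orP; left; apply/eqP.
by rewrite /z; field; rewrite gt_eqF.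
Qed.

(** * The kernel on cells *)

Lemma integral_fejer_itv_co (R : realType) (h y : R) M n : 0 < h -> (0 < M)%N ->
  (\int[@lebesgue_measure R]_(x in `[y, (y + n%:R * h)%R[) (fejer h M x)%:E =
   (n%:R * h)%:E)%E.
Proof.
move=> h0 M0.
have mf : measurable_fun setT (fun x => (fejer h M x)%:E).
  by apply/measurable_EFinP; exact: measurable_fejer.
elim: n => [|n IH]; first by rewrite mul0r addr0 set_itvxx integral_set0.
have e : y + n.+1%:R * h = y + n%:R * h + h by rewrite -natr1 mulrDl mul1r addrA.
have -> : `[y, y + n.+1%:R * h[%classic =
    (`[y, (y + n%:R * h)%R[ `|` `[(y + n%:R * h)%R, (y + n%:R * h + h)%R[)%classic :> set R.
  by rewrite -itv_bndbnd_setU ?e// bnd_simp ?lerDl ?mulr_ge0 ?(ltW h0).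
rewrite ge0_integral_setU//=; first last.
- rewrite disj_set2E; apply/eqP; rewrite -subset0 => x [] /=; rewrite !in_itv /=.
  by move=> /andP[_ +] /andP[+ _]; move=> /lt_le_trans /[apply]; rewrite ltxx.
- by move=> x _; rewrite lee_fin fejer_ge0.
- exact: measurable_funTS.
rewrite IH integral_itv_bndo_bndc//; last exact: measurable_funTS.
by rewrite integral_fejer_period// -EFinD -natr1 mulrDl mul1r.
Qed.

Lemma integral_mul_fejer_itv_le (R : realType) (w : R -> R) (q h y : R) M :
  0 < h -> (0 < M)%N -> measurable_fun setT w -> (forall x, 0 <= w x) ->
  (forall x, y <= x < y + h -> w x <= q) ->
  (\int[@lebesgue_measure R]_(x in `[y, (y + h)%R[) (w x * fejer h M x)%:E <= (q * h)%:E)%E.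
Proof.
move=> h0 M0 mw w0 wq.
have q0 : 0 <= q by apply: le_trans (w0 y) (wq y _); rewrite lexx ltrDl.
have mf := measurable_fejer R h M.
apply: (@le_trans _ _ (\int[@lebesgue_measure R]_(x in `[y, (y + h)%R[)
   (q%:E * (fejer h M x)%:E))%E).
  apply: ge0_le_integral => //.
  - by move=> x _; rewrite lee_fin mulr_ge0 ?fejer_ge0.
  - by apply: measurable_funTS; apply/measurable_EFinP; exact: measurable_funM.
  - by apply: measurable_funTS; apply: measurable_funeM; apply/measurable_EFinP.
  - move=> x /=; rewrite in_itv /= => xy.
    by rewrite -EFinM lee_fin ler_wpM2r ?fejer_ge0 ?wq.
rewrite ge0_integralZl_EFin//; last 2 first.
- by move=> x _; rewrite lee_fin fejer_ge0.
- by apply: measurable_funTS; apply/measurable_EFinP.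
have := @integral_fejer_itv_co R h y M 1 h0 M0; rewrite !mul1r => ->.
by rewrite -EFinM.
Qed.

(* The cells of mesh [h] are centred at the lattice points. *)
Definition halfcell {R : realType} (h : R) (k : nat) : R := (k%:R + 2^-1) * h.

Lemma halfcellS (R : realType) (h : R) k : halfcell h k.+1 = halfcell h k + h.
Proof. by rewrite /halfcell -natr1; ring. Qed.

Lemma halfcell_ge0 (R : realType) (h : R) k : 0 < h -> 0 <= halfcell h k.
Proof. by move=> h0; rewrite mulr_ge0 ?addr_ge0 ?invr_ge0 ?(ltW h0). Qed.

(** Passing from [n] to [n.+1] adds one cell on either side of the box; on both the weight is at
    most [q n] and the kernel has mass [h]. The initial bound [B] is left free: it will be 0 for a
    weight vanishing on the box, and [h] for a single central cell. *)
Lemma integral_mul_fejer_shells (R : realType) (w : R -> R) (q : nat -> R) (h : R)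
    M m n (B : \bar R) :
  0 < h -> (0 < M)%N -> measurable_fun setT w -> (forall x, 0 <= w x) ->
  (\int[@lebesgue_measure R]_(x in `[(- halfcell h m)%R, (halfcell h m)%R[)
     (w x * fejer h M x)%:E <= B)%E ->
  (forall i x, halfcell h (m + i) <= `|x| -> w x <= q i) ->
  (\int[@lebesgue_measure R]_(x in `[(- halfcell h (m + n))%R, (halfcell h (m + n))%R[)
     (w x * fejer h M x)%:E <= B + (2 * h * \sum_(i < n) q i)%R%:E)%E.
Proof.
move=> h0 M0 mw w0 wB wq.
have mf : measurable_fun setT (fun x => (w x * fejer h M x)%:E).
  apply/measurable_EFinP; apply: measurable_funM => //; exact: measurable_fejer.
have wf0 x : (0 <= (w x * fejer h M x)%:E)%E by rewrite lee_fin mulr_ge0 ?fejer_ge0.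
elim: n => [|n IH]; first by rewrite addn0 big_ord0 mulr0 adde0.
rewrite addnS halfcellS; set X := halfcell h (m + n).
have X0 : 0 <= X by exact: halfcell_ge0.
have -> : `[- (X + h), X + h[%classic =
   ((`[- (X + h), - (X + h) + h[ `|` `[- X, X[) `|` `[X, (X + h)%R[)%classic :> set R.
  rewrite (_ : - (X + h) + h = - X); last by ring.
  rewrite -itv_bndbnd_setU ?bnd_simp ?lerN2 ?lerDl ?(ltW h0)//; last first.
    by rewrite (le_trans _ X0)// oppr_le0.
  rewrite -itv_bndbnd_setU ?bnd_simp ?lerDl ?(ltW h0)//.
  by rewrite (le_trans _ X0)// oppr_le0 addr_ge0// ltW.
rewrite ge0_integral_setU//=; first last.
- rewrite disj_set2E; apply/eqP; rewrite -subset0 => x [[|]] /=; rewrite !in_itv /=.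
    by move=> /andP[_ xX] /andP[Xx _]; move: X0 xX Xx; lra.
  by move=> /andP[_ xX] /andP[Xx _]; move: X0 xX Xx; lra.
- exact: measurable_funTS.
- exact: measurableU.
rewrite ge0_integral_setU//=; first last.
- rewrite disj_set2E; apply/eqP; rewrite -subset0 => x [] /=; rewrite !in_itv /=.
  by move=> /andP[_ xX] /andP[Xx _]; move: X0 xX Xx; lra.
- exact: measurable_funTS.
have l1 := @integral_mul_fejer_itv_le R w (q n) h (- (X + h)) M h0 M0 mw w0.
have l2 := @integral_mul_fejer_itv_le R w (q n) h X M h0 M0 mw w0.
apply: (@le_trans _ _ ((q n * h)%:E + (B + (2 * h * \sum_(i < n) q i)%R%:E) + (q n * h)%:E)%E).
  apply: leeD; first apply: leeD => //.
    by apply: l1 => x /andP[_ xX]; apply: wq; rewrite -/X ler_normr; apply/orP; right; lra.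
  by apply: l2 => x /andP[xX _]; apply: wq; rewrite -/X ler_normr xX.
rewrite big_ord_recr /= addeC addeA addeCA -addeA -!EFinD.
rewrite leeD2l// lee_fin; lra.
Qed.

(** Monotone convergence along the growing boxes turns a uniform bound on the shell sums into one on
    the whole line. *)
Lemma integral_mul_fejer_le (R : realType) (w : R -> R) (q : nat -> R) (h : R)
    M m (B C : R) :
  0 < h -> (0 < M)%N -> measurable_fun setT w -> (forall x, 0 <= w x) ->
  (\int[@lebesgue_measure R]_(x in `[(- halfcell h m)%R, (halfcell h m)%R[)
     (w x * fejer h M x)%:E <= B%:E)%E ->
  (forall i x, halfcell h (m + i) <= `|x| -> w x <= q i) ->
  (forall n, B + 2 * h * \sum_(i < n) q i <= C) ->
  (\int[@lebesgue_measure R]_x (w x * fejer h M x)%:E <= C%:E)%E.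
Proof.
move=> h0 M0 mw w0 wB wq qC.
have mf : measurable_fun setT (fun x => (w x * fejer h M x)%:E).
  apply/measurable_EFinP; apply: measurable_funM => //; exact: measurable_fejer.
have wf0 x : (0 <= (w x * fejer h M x)%:E)%E by rewrite lee_fin mulr_ge0 ?fejer_ge0.
pose F n := `[- halfcell h (m + n), halfcell h (m + n)[%classic.
have Fn : nondecreasing_seq F.
  apply/nondecreasing_seqP => n; rewrite subsetEset /F addnS halfcellS => x /=.
  by rewrite !in_itv /=; move: h0; lra.
have UF : \bigcup_n F n = setT.
  rewrite -subTset => x _; exists (Num.truncn (`|x| / h)).+1 => //.
  rewrite /F /= in_itv /=.
  suff : `|x| < halfcell h (m + (Num.truncn (`|x| / h)).+1).
    by rewrite ltr_norml => /andP[/ltW -> ->].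
  rewrite /halfcell -ltr_pdivrMr//; apply: lt_le_trans (truncnS_gt _) _.
  rewrite (@le_trans _ _ ((m + (Num.truncn (`|x| / h)).+1)%:R))//.
    by rewrite ler_nat leq_addl.
  by rewrite lerDl invr_ge0.
have c : (\int[@lebesgue_measure R]_(x in F n) (w x * fejer h M x)%:E @[n --> \oo] -->
    \int[@lebesgue_measure R]_(x in \bigcup_n F n) (w x * fejer h M x)%:E)%E.
  apply: (@ge0_nondecreasing_set_cvg_integral _ (measurableTypeR R) _
    F (fun x => (w x * fejer h M x)%:E) (@lebesgue_measure R)) => //.
  - by move=> n; exact: measurable_itv.
  - by move=> n; apply: measurable_funTS.
rewrite UF in c; rewrite -(cvg_lim _ c)//; apply: lime_le; first by apply/cvgP: c.
apply: nearW => n.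
apply: le_trans (integral_mul_fejer_shells R w q h M m n _ h0 M0 mw w0 wB wq) _.
by rewrite -EFinD lee_fin.
Qed.

(** * Exponential weights integrated against the kernel *)

(** Write [(x + y)^d] as [x (x + y)^(d - 1) + y (x + y)^(d - 1)]; since [1 <= d], the power [d - 1]
    is monotone. *)
Lemma powR_superadd (R : realType) (d x y : R) : 1 <= d -> 0 <= x -> 0 <= y ->
  x `^ d + y `^ d <= (x + y) `^ d.
Proof.
move=> d1 x0 y0; have d0 : 0 < d by exact: lt_le_trans ltr01 d1.
have dm : 0 <= d - 1 by rewrite subr_ge0.
rewrite -(mulr_powRB1 x0 d0) -(mulr_powRB1 y0 d0) -(mulr_powRB1 (addr_ge0 x0 y0) d0) mulrDl.
apply: lerD; apply: ler_wpM2l => //; apply: ge0_ler_powR => //; rewrite ?nnegrE ?addr_ge0//.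
  by rewrite lerDl.
by rewrite lerDr.
Qed.

(** One-coordinate factor of the reciprocal of [expweight]; it serves for the decay of [f] and for
    that of its transform. *)
Definition gexp {R : realType} (c d x : R) : R := expR (- (c * `|x| `^ d)).

Lemma gexp_ge0 (R : realType) (c d x : R) : 0 <= gexp c d x.
Proof. exact: expR_ge0. Qed.

Lemma measurable_gexp (R : realType) (c d : R) : measurable_fun setT (gexp c d).
Proof.
apply: measurableT_comp; first exact: measurable_expR.
apply: measurableT_comp => //; apply: measurable_funM => //.
apply: (@measurableT_comp _ _ _ _ _ _ (fun x : R => x `^ d)); first exact: measurable_powR.
exact: normr_measurable.
Qed.

Lemma gexp_le1 (R : realType) (c d x : R) : 0 <= c -> gexp c d x <= 1.
Proof. by move=> c0; rewrite expR_le1 oppr_le0 mulr_ge0 ?powR_ge0. Qed.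

Lemma gexp_anti (R : realType) (c d x y : R) : 0 <= c -> 0 <= d ->
  0 <= x -> x <= `|y| -> gexp c d y <= gexp c d x.
Proof.
move=> c0 d0 x0 xy; rewrite ler_expR lerN2 ler_wpM2l// (ger0_norm x0).
by apply: ge0_ler_powR; rewrite ?nnegrE.
Qed.

(** With [x] at the face of the box and [y] the distance beyond it, this pulls the value at the face
    out of the tail sum. *)
Lemma gexpD (R : realType) (c d x y : R) : 0 <= c -> 1 <= d -> 0 <= x -> 0 <= y ->
  gexp c d (x + y) <= gexp c d x * gexp c d y.
Proof.
move=> c0 d1 x0 y0; rewrite -expRD ler_expR -opprD lerN2 -mulrDr ler_wpM2l//.
by rewrite !ger0_norm ?addr_ge0// powR_superadd.
Qed.

(** The term [i = 0] costs at most [h]; the others are compared with Euler's integral. *)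
Lemma sum_gexp_le (R : realType) (c d h : R) n : 0 < c -> 0 < d -> 0 < h ->
  h * \sum_(i < n) gexp c d (i%:R * h) <= h + Gammaf d^-1 / (d * c `^ d^-1).
Proof.
move=> c0 d0 h0; have G0 := sum_expR_powR_le_gamma R d c h 0 d0 c0 h0.
rewrite big_ord0 mulr0 in G0.
case: n => [|n]; first by rewrite big_ord0 mulr0 addr_ge0// ltW.
rewrite big_ord_recl mulrDr lerD//.
  by rewrite ler_piMr ?(ltW h0)// gexp_le1// ltW.
apply: le_trans (sum_expR_powR_le_gamma R d c h n d0 c0 h0).
rewrite ler_pM2l//; apply: ler_sum => i _.
by rewrite /gexp ger0_norm// mulr_ge0// ltW.
Qed.

Lemma sum_gexp_halfcell (R : realType) (c d h : R) m n : 0 < c -> 1 <= d -> 0 < h ->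
  2 * h * \sum_(i < n) gexp c d (halfcell h (m + i)) <=
  2 * gexp c d (halfcell h m) * (h + Gammaf d^-1 / (d * c `^ d^-1)).
Proof.
move=> c0 d1 h0; have d0 : 0 < d by exact: lt_le_trans ltr01 d1.
rewrite -!mulrA ler_pM2l//.
apply: (@le_trans _ _ (gexp c d (halfcell h m) * (h * \sum_(i < n) gexp c d (i%:R * h)))).
  rewrite mulrCA ler_pM2l// mulr_sumr; apply: ler_sum => i _.
  rewrite (_ : halfcell h (m + i) = halfcell h m + i%:R * h); last first.
    by rewrite /halfcell natrD; ring.
  by apply: gexpD => //; [exact: ltW|exact: halfcell_ge0|rewrite mulr_ge0// ltW].
by apply: ler_wpM2l; [exact: gexp_ge0|exact: sum_gexp_le].
Qed.

Lemma integral_gexp_fejer_out (R : realType) (c d h : R) M m :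
  0 < c -> 1 <= d -> 0 < h -> (0 < M)%N ->
  (\int[@lebesgue_measure R]_x
     (\1_(~` `[(- halfcell h m)%R, (halfcell h m)%R[) x * gexp c d x * fejer h M x)%R%:E <=
   (2 * gexp c d (halfcell h m) * (h + Gammaf d^-1 / (d * c `^ d^-1)))%R%:E)%E.
Proof.
move=> c0 d1 h0 M0; have d0 : 0 < d by exact: lt_le_trans ltr01 d1.
apply: (integral_mul_fejer_le R
  (fun x => \1_(~` `[- halfcell h m, halfcell h m[) x * gexp c d x)
  (fun i => gexp c d (halfcell h (m + i))) h M m 0) => //.
- apply: measurable_funM; last exact: measurable_gexp.
  by apply: measurable_indic; exact: measurableC.
- by move=> x; rewrite mulr_ge0 ?gexp_ge0.
- by rewrite integral0_eq// => x xX; rewrite indicE memNset ?mul0r//=.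
- move=> i x xi; apply: (@le_trans _ _ (gexp c d x)).
    rewrite ler_piMl ?gexp_ge0// indicE; by case: (_ \in _).
  by apply: gexp_anti => //; [exact: ltW|exact: ltW|exact: halfcell_ge0].
- by move=> n; rewrite add0r sum_gexp_halfcell.
Qed.

(** One [h] comes from the central cell, where the weight is at most 1, and two more from the terms
    [i = 0] of the tails on the two sides. *)
Lemma integral_gexp_fejer (R : realType) (c d h : R) M :
  0 < c -> 1 <= d -> 0 < h -> (0 < M)%N ->
  (\int[@lebesgue_measure R]_x (gexp c d x * fejer h M x)%R%:E <=
   (3 * h + 2 * (Gammaf d^-1 / (d * c `^ d^-1)))%R%:E)%E.
Proof.
move=> c0 d1 h0 M0; have d0 : 0 < d by exact: lt_le_trans ltr01 d1.
have G0 := sum_expR_powR_le_gamma R d c h 0 d0 c0 h0.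
rewrite big_ord0 mulr0 in G0.
apply: (integral_mul_fejer_le R (gexp c d)
  (fun i => gexp c d (halfcell h (0 + i))) h M 0 h) => //.
- exact: measurable_gexp.
- by move=> x; exact: gexp_ge0.
- have e : halfcell h 0 = - halfcell h 0 + h by rewrite /halfcell; field.
  rewrite {2}e -[X in (_ <= X%:E)%E]mul1r; apply: integral_mul_fejer_itv_le => //.
  + exact: measurable_gexp.
  + by move=> x; exact: gexp_ge0.
  + by move=> x _; rewrite gexp_le1 ?ltW.
- move=> i x xi.
  by apply: gexp_anti => //; [exact: ltW|exact: ltW|exact: halfcell_ge0].
- move=> n; have := sum_gexp_halfcell R c d h 0 n c0 d1 h0.
  have := gexp_le1 R c d (halfcell h 0) (ltW c0).
  set g := gexp _ _ _; set G := _ / _ in G0 * => g1 le1.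
  have : 2 * g * (h + G) <= 2 * (h + G).
    by rewrite ler_wpM2r ?addr_ge0 ?(ltW h0)//; move: g1; lra.
  move: le1; lra.
Qed.

(** * Pointwise bounds from the norm *)

Definition cube {R : realType} {s : nat} (x : 'rV[R]_s) (e : R) : set 'rV[R]_s :=
  [set y | forall j, `](x 0 j - e), (x 0 j + e)[%classic (y 0 j)].

Lemma lebesgue_rV_cube_gt0 (R : realType) s (x : 'rV[R]_s) (e : R) : 0 < e ->
  measurable (cube x e) /\ (0 < lebesgue_rV s (cube x e))%E.
Proof.
move=> e0; split.
  rewrite (_ : cube x e = \bigcap_(j in [set: 'I_s])
     ((fun y : 'rV[R]_s => y 0 j) @^-1` `](x 0 j - e), (x 0 j + e)[)).
    apply: fin_bigcap_measurable => // j _.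
    by rewrite -[X in measurable X]setTI; exact: measurable_rV_coord.
  by apply/seteqP; split => y /= h => [j _|j]; [exact: h|exact: h].
rewrite [X in (0 < X)%E](@lebesgue_rV_box R s
  (fun j => `](x 0 j - e), (x 0 j + e)[%classic)) => [|j]; last exact: measurable_itv.
rewrite (_ : (\prod_(i < s) _)%E = (\prod_(i < s) (2 * e))%:E).
  by rewrite lte_fin prodr_gt0// => j _; rewrite mulr_gt0.
rewrite -prodEFin; apply: eq_bigr => j _.
rewrite lebesgue_measure_itv /= lte_fin ltrD2l gtrN//.
by rewrite -EFinD; congr _%:E; ring.
Qed.

(** A null set contains no open cube, so the property holds at points arbitrarily close to [x]. With
    continuity, this makes essential bounds pointwise. *)
Lemma ae_rV_seq (R : realType) s (P : 'rV[R]_s -> Prop) (x : 'rV[R]_s) :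
  {ae lebesgue_rV s, forall y, P y} ->
  exists y : nat -> 'rV[R]_s, (forall n, P (y n)) /\
    (forall n j, `|x 0 j - y n 0 j| < n.+1%:R^-1).
Proof.
move=> [N [mN N0 PN]].
suff /choice[y yP] : forall n, exists y : 'rV[R]_s, P y /\
    forall j, `|x 0 j - y 0 j| < n.+1%:R^-1.
  by exists y; split => n; [have [] := yP n|have [_] := yP n].
move=> n; apply: contrapT => nP.
have e0 : 0 < n.+1%:R^-1 :> R by rewrite invr_gt0.
have [mA A0] := lebesgue_rV_cube_gt0 R s x _ e0.
move: A0; rewrite (subset_measure0 mA mN _ N0) ?ltxx// => y /= yx.
apply: PN => Py; apply: nP; exists y; split => // j.
have := yx j; rewrite /= in_itv /= => /andP[y1 y2].
by rewrite ltr_norml; apply/andP; split; move: y1 y2; move: (_^-1) => e; lra.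
Qed.

Lemma continuous_norm_powR (R : realType) (p : R) : 0 < p ->
  continuous (fun t : R => `|t| `^ p).
Proof.
move=> p0 t; have [->|t0] := eqVneq t 0.
  rewrite /continuous_at normr0 powR0 ?gt_eqF//.
  apply/cvgrPdist_lt => e e0; near=> u.
  rewrite sub0r normrN ger0_norm ?powR_ge0//.
  rewrite [ltRHS](_ : e = (e `^ p^-1) `^ p); last first.
    by rewrite -powRrM mulVf ?gt_eqF// powRr1// ltW.
  apply: gt0_ltr_powR; rewrite ?nnegrE ?powR_ge0//.
  near: u; exists (e `^ p^-1); first exact: powR_gt0.
  by move=> u /=; rewrite sub0r normrN.
apply: (@continuous_comp _ _ _ (fun t : R => `|t|) (fun t => t `^ p)).
  exact: norm_continuous.
by apply: continuous_at_is_derive; apply: is_derive1_powR; rewrite normr_gt0.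
Unshelve. all: by end_near. Qed.

Lemma cvg_coord_seq (R : realType) s (x : 'rV[R]_s) (y : nat -> 'rV[R]_s) j :
  (forall n j, `|x 0 j - y n 0 j| < n.+1%:R^-1) -> (fun n => y n 0 j) @ \oo --> x 0 j.
Proof.
move=> yx; apply/cvgrPdist_lt => e e0.
have /cvgrPdist_lt/(_ e e0) := @cvg_harmonic R.
apply: filterS => n; rewrite sub0r normrN ger0_norm ?invr_ge0//.
exact: lt_trans (yx n j).
Qed.

Lemma cvg_rV_seq (R : realType) s (x : 'rV[R]_s) (y : nat -> 'rV[R]_s) :
  (forall n j, `|x 0 j - y n 0 j| < n.+1%:R^-1) -> y @ \oo --> x.
Proof.
move=> yx; apply/cvg_ballP => e e0.
have /cvgrPdist_lt/(_ e e0) := @cvg_harmonic R.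
apply: filterS => n; rewrite sub0r normrN ger0_norm ?invr_ge0// => ne.
split => // i j; rewrite (ord1 i).
exact: lt_trans (yx n j) ne.
Qed.

Lemma cvg_expweight (R : realType) s (u p : 'I_s -> R) (x : 'rV[R]_s) (y : nat -> 'rV[R]_s) :
  (forall j, 0 < p j) -> (forall j, (fun n => y n 0 j) @ \oo --> x 0 j) ->
  (fun n => expweight u p (y n)) @ \oo --> expweight u p x.
Proof.
move=> p0 yx; rewrite /expweight.
apply: (@continuous_cvg _ _ _ _ _ (fun n => \sum_(j < s) u j * (`|y n 0 j| `^ p j)) (@expR R)).
  exact: continuous_expR.
apply: cvg_big => [|j _]; first exact: add_continuous.
apply: cvgMr; apply: (@continuous_cvg _ _ _ _ _ (fun n => y n 0 j) (fun t => `|t| `^ p j)).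
  exact: continuous_norm_powR.
exact: yx.
Qed.

Lemma expweight_gexp (R : realType) s (u p : 'I_s -> R) (x : 'rV[R]_s) :
  \prod_j gexp (u j) (p j) (x 0 j) = (expweight u p x)^-1.
Proof. by rewrite -expRN -sumrN expR_sum. Qed.

(** The norm of exponent [+oo] unfolds to the essential supremum only when the whole space has
    positive measure. *)
Lemma lebesgue_rV_setT_gt0 (R : realType) s : (0 < lebesgue_rV s [set: 'rV[R]_s])%E.
Proof.
have [mA A0] := lebesgue_rV_cube_gt0 R s 0 1 ltr01.
by apply: lt_le_trans A0 _; apply: le_measure; rewrite ?inE.
Qed.

Lemma Re_le_normc (R : realType) (z : R[i]) : `|complex.Re z| <= Normc.normc z.
Proof.
by case: z => x y /=; rewrite -sqrtr_sqr ler_wsqrtr// lerDl sqr_ge0.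
Qed.

Lemma Lnorm_y_ae (R : realType) s (g : 'rV[R]_s -> R) (B : R) :
  Lnorm (lebesgue_rV s) +oo (fun x => (g x)%:E) = B%:E ->
  {ae lebesgue_rV s, forall x, `|g x| <= B}.
Proof.
rewrite unlock lebesgue_rV_setT_gt0 => eB.
have := ess_sup_ge (lebesgue_rV s) (abse \o (fun x => (g x)%:E)).
by rewrite eB; apply: filterS => x /=; rewrite lee_fin.
Qed.

(** Continuity of the transform of an integrable function, by dominated convergence with majorant
    [|f|]. *)
Lemma cvg_Re_fourier (R : realType) s (f : 'rV[R]_s -> R) (x : 'rV[R]_s)
    (y : nat -> 'rV[R]_s) :
  (lebesgue_rV s).-integrable setT (EFin \o f) ->
  (forall j, (fun n => y n 0 j) @ \oo --> x 0 j) ->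
  (fun n => complex.Re (fourier f (y n))) @ \oo --> complex.Re (fourier f x).
Proof.
move=> fi yx; rewrite Re_fourier.
under eq_fun do rewrite Re_fourier.
have mf : measurable_fun setT f by apply/measurable_EFinP; exact: measurable_int fi.
have ci xi : (lebesgue_rV s).-integrable setT
    (EFin \o (fun x => f x * cos (2 * pi * dot xi x))).
  apply: (integrable_mul_bounded _ _ _ _ _ _ 1) => //; first exact: measurable_cos_dot.
  by move=> z; exact: cos_max.
have mc xi : measurable_fun setT (fun z : 'rV[R]_s => (f z * cos (2 * pi * dot xi z))%:E).
  by apply/measurable_EFinP; apply: measurable_funM => //; exact: measurable_cos_dot.
have [] := @dominated_convergence _ _ _ (lebesgue_rV s) _ measurableT
  (fun n z => (f z * cos (2 * pi * dot (y n) z))%:E)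
  (fun z => (f z * cos (2 * pi * dot x z))%:E) (abse \o (EFin \o f)).
- by move=> n; exact: mc.
- exact: mc.
- apply: aeW => z _; apply: cvg_EFin; first exact: nearW.
  apply: cvgMr.
  apply: (@continuous_cvg _ _ _ _ _ (fun n => 2 * pi * dot (y n) z) (@cos R)).
    exact: continuous_cos.
  apply: cvgMr; apply: cvg_big => [|j _]; first exact: add_continuous.
  by apply: cvgMl; exact: yx.
- exact: integrable_abse.
- apply: aeW => z n _ /=; rewrite lee_fin normrM ler_piMr//; exact: cos_max.
move=> _ _ l.
have e : (\int[lebesgue_rV s]_z (f z * cos (2 * pi * dot x z))%:E)%E \is a fin_num.
  exact: (integrable_fin_num measurableT (ci x)).
by move: l; rewrite -(fineK e) => /fine_cvgP[_ l]; exact: l.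
Qed.

Lemma ge0_fin_numD (R : realType) (x y : \bar R) :
  (0 <= x -> 0 <= y -> x + y < +oo -> x \is a fin_num /\ y \is a fin_num)%E.
Proof.
by move=> x0 y0 xy; split; rewrite ge0_fin_numE// (le_lt_trans _ xy)// ?leeDl ?leeDr.
Qed.

Lemma Lnorm_y_decay (R : realType) s (c d : 'I_s -> R) (f : 'rV[R]_s -> R) (B : R) x :
  (forall j, 0 < d j) -> continuous f ->
  Lnorm (lebesgue_rV s) +oo (fun x => (f x * expweight c d x)%:E) = B%:E ->
  `|f x| <= B * \prod_j gexp (c j) (d j) (x 0 j).
Proof.
move=> d0 cf eB.
have w0 (z : 'rV[R]_s) : 0 < expweight c d z by exact: expR_gt0.
rewrite expweight_gexp ler_pdivlMr//.
have [y [yB yx]] := ae_rV_seq R s _ x (Lnorm_y_ae R s _ _ eB).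
have l : (fun n => f (y n) * expweight c d (y n)) @ \oo --> f x * expweight c d x.
  apply: cvgM.
    by apply: (@continuous_cvg _ _ _ _ _ y f); [exact: cf|exact: cvg_rV_seq].
  by apply: cvg_expweight => // j; exact: cvg_coord_seq.
rewrite -[X in _ * X](ger0_norm (ltW (w0 x))) -normrM.
apply: (ler_cvg_to (cvg_norm l) (@cvg_cst _ B _ _ _)).
by apply: nearW => n; exact: yB.
Qed.

Lemma Lnorm_y_fourier_decay (R : realType) s (a b : 'I_s -> R) (f : 'rV[R]_s -> R) (B : R) x :
  (forall j, 0 < b j) -> (lebesgue_rV s).-integrable setT (EFin \o f) ->
  Lnorm (lebesgue_rV s) +oo
    (fun xi => (Normc.normc (fourier f xi) * expweight a b xi)%:E) = B%:E ->
  `|complex.Re (fourier f x)| <= B * \prod_j gexp (a j) (b j) (x 0 j).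
Proof.
move=> b0 fi eB.
have w0 (z : 'rV[R]_s) : 0 < expweight a b z by exact: expR_gt0.
rewrite expweight_gexp ler_pdivlMr//.
have [y [yB yx]] := ae_rV_seq R s _ x (Lnorm_y_ae R s _ _ eB).
have l : (fun n => complex.Re (fourier f (y n)) * expweight a b (y n)) @ \oo -->
    complex.Re (fourier f x) * expweight a b x.
  apply: cvgM.
    by apply: cvg_Re_fourier => // j; exact: cvg_coord_seq.
  by apply: cvg_expweight => // j; exact: cvg_coord_seq.
rewrite -[X in _ * X](ger0_norm (ltW (w0 x))) -normrM.
apply: (ler_cvg_to (cvg_norm l) (@cvg_cst _ B _ _ _)).
apply: nearW => n; apply: le_trans (yB n).
by rewrite !normrM ler_wpM2r// (le_trans (Re_le_normc _ _))// ler_norm.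
Qed.

(** The two halves of the norm are kept apart: [B1] controls the truncation and [B2] the
    aliasing. *)
Lemma E_space_bounds (R : realType) s (a b c d : 'I_s -> R) (f : 'rV[R]_s -> R) :
  (forall j, 0 < b j) -> (forall j, 0 < d j) ->
  E_space (expweight c d) (expweight a b) f ->
  exists B1 B2 : R, [/\ 0 <= B1, 0 <= B2,
    E_norm (expweight c d) (expweight a b) f = (B1 + B2)%:E,
    forall x, `|f x| <= B1 * \prod_j gexp (c j) (d j) (x 0 j) &
    forall xi, `|complex.Re (fourier f xi)| <= B2 * \prod_j gexp (a j) (b j) (xi 0 j)].
Proof.
move=> b0 d0 [cf fi]; rewrite /E_norm.
have := fun x B => Lnorm_y_decay R s c d f B x d0 cf.
have := fun x B => Lnorm_y_fourier_decay R s a b f B x b0 fi.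
have := Lnorm_ge0 (lebesgue_rV s) +oo (fun x => (f x * expweight c d x)%:E).
have := Lnorm_ge0 (lebesgue_rV s) +oo
  (fun xi => (Normc.normc (fourier f xi) * expweight a b xi)%:E).
move: (Lnorm _ _ _) => N2; move: (Lnorm _ _ _) => N1.
move=> N20 N10 h2 h1 N12.
have [N1f N2f] := ge0_fin_numD _ _ _ N10 N20 N12.
exists (fine N1), (fine N2); split.
- exact: fine_ge0.
- exact: fine_ge0.
- by rewrite EFinD !fineK.
- by move=> x; apply: h1; rewrite fineK.
- by move=> x; apply: h2; rewrite fineK.
Qed.

(** * Aliasing *)

(** As [q] varies, [p - q] takes the value 0 once and every other integer at most once: the diagonal
    gives 1 and each side at most [th]. *)
Lemma sum_gexp_dist (R : realType) (a b h th : R) M (p : 'I_M) : 0 < b ->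
  (forall n, \sum_(k < n) gexp a b (k.+1%:R / h) <= th) ->
  \sum_(q < M) gexp a b ((p%:R - q%:R) / h) <= 1 + 2 * th.
Proof.
move=> b0 thP.
rewrite -(big_mkord xpredT (fun q => gexp a b ((p%:R - q%:R) / h))).
rewrite (@big_cat_nat _ _ _ p) /=; [|exact: leq0n|exact: ltnW].
rewrite [X in _ + X]big_ltn// subrr mul0r.
have -> : gexp a b 0 = 1 by rewrite /gexp normr0 powR0 ?gt_eqF// mulr0 oppr0 expR0.
suff l1 : \sum_(0 <= q < p) gexp a b ((p%:R - q%:R) / h) <= th.
  suff l2 : \sum_(p.+1 <= q < M) gexp a b ((p%:R - q%:R) / h) <= th by move: l1 l2; lra.
  rewrite -[p.+1]add0n big_addn big_mkord; apply: le_trans (thP _).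
  apply: ler_sum => i _; rewrite /gexp -normrN.
  rewrite (_ : - ((p%:R - (i + p.+1)%:R) / h) = i.+1%:R / h)//.
  by rewrite natrD -[p.+1%:R]natr1 -[i.+1%:R]natr1; ring.
(* Reversing the order makes the distances [p - q] run upwards from 1. *)
rewrite big_nat_rev big_mkord /=; apply: le_trans (thP p).
apply: ler_sum => i _; rewrite add0n natrB//.
by rewrite opprB addrC subrK.
Qed.

(** The [M^s] tuples of equal pairs have frequency 0 and together give exactly [Iint f]. The other
    values are bounded by the decay of the transform; adding and subtracting the diagonal tuples
    keeps the sum in product form, whence the [- 1]. *)
Lemma alias_bound (R : realType) s (a b h th : 'I_s -> R) (f : 'rV[R]_s -> R) (B : R) M :
  (0 < M)%N -> (forall j, 0 < b j) -> 0 <= B ->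
  (lebesgue_rV s).-integrable setT (EFin \o f) ->
  (forall xi, `|complex.Re (fourier f xi)| <= B * \prod_j gexp (a j) (b j) (xi 0 j)) ->
  (forall j n, \sum_(k < n) gexp (a j) (b j) (k.+1%:R / h j) <= th j) ->
  `|Rintegral (lebesgue_rV s) setT (fun x => f x * \prod_j fejer (h j) M (x 0 j)) - Iint f| <=
  B * (\prod_j (1 + 2 * th j) - 1).
Proof.
move=> M0 b0 B0 fi fB thP; rewrite Rintegral_fejer//.
have M0' : (M%:R : R) != 0 by rewrite pnatr_eq0 -lt0n.
have MsV : 0 < M%:R ^- s :> R by rewrite invr_gt0 exprn_gt0 ?ltr0n.
pose xi (P : {ffun 'I_s -> 'I_M * 'I_M}) : 'rV[R]_s :=
  \row_j (((P j).1%:R - (P j).2%:R) / h j).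
(* Indicator of the tuples whose pairs are all diagonal; being a product over the coordinates, it is
   summed as a product. *)
pose dl (P : {ffun 'I_s -> 'I_M * 'I_M}) : R := \prod_j ((P j).1 == (P j).2)%:R.
pose e (P : {ffun 'I_s -> 'I_M * 'I_M}) : R := \prod_j gexp (a j) (b j) (xi P 0 j).
have I0 : Iint f = complex.Re (fourier f 0).
  rewrite Re_fourier; apply: eq_Rintegral => x _.
  rewrite /dot big1 ?mulr0 ?cos0 ?mulr1// => j _.
  by rewrite mxE mul0r.
have sdl : \sum_P dl P = M%:R ^+ s.
  rewrite /dl -(bigA_distr_bigA (fun (j : 'I_s) (pq : 'I_M * 'I_M) => (pq.1 == pq.2)%:R)).
  rewrite -[s in RHS](card_ord s) -prodr_const; apply: eq_bigr => j _.
  rewrite -(pair_big xpredT xpredT (fun p q : 'I_M => (p == q)%:R)) /=.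
  under eq_bigr => p _.
    rewrite (bigD1 p)//= eqxx big1 ?addr0; last by move=> q; rewrite eq_sym => /negbTE ->.
    over.
  by rewrite sumr_const card_ord.
have se : \sum_P e P <= M%:R ^+ s * \prod_j (1 + 2 * th j).
  rewrite -[s in _ ^+ s](card_ord s) -prodr_const -big_split /=.
  have eE P : true -> e P = \prod_j gexp (a j) (b j) (((P j).1%:R - (P j).2%:R) / h j).
    by move=> _; apply: eq_bigr => j _; rewrite mxE.
  rewrite (eq_bigr _ eE).
  rewrite -(bigA_distr_bigA (fun (j : 'I_s) (pq : 'I_M * 'I_M) =>
    gexp (a j) (b j) ((pq.1%:R - pq.2%:R) / h j))).
  apply: ler_prod => j _; rewrite sumr_ge0/= => [|pq _]; last exact: gexp_ge0.
  rewrite -(pair_big xpredT xpredT (fun p q : 'I_M =>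
    gexp (a j) (b j) ((p%:R - q%:R) / h j))) /=.
  apply: (@le_trans _ _ (\sum_(p < M) (1 + 2 * th j))).
    by apply: ler_sum => p _; exact: (sum_gexp_dist _ _ _ _ _ _ _ (b0 j) (thP j)).
  by rewrite sumr_const card_ord -[X in X <= _]mulr_natl.
have step P : `|complex.Re (fourier f (xi P)) - dl P * Iint f| <= B * (e P - dl P).
  have [/forallP D|] := boolP [forall j, (P j).1 == (P j).2].
    have -> : dl P = 1 by rewrite /dl big1// => j _; rewrite D.
    have x0 : xi P = 0.
      by apply/rowP => j; rewrite !mxE (eqP (D j)) subrr mul0r.
    rewrite x0 -I0 mul1r subrr normr0 /e big1 ?subrr ?mulr0// => j _.
    by rewrite x0 mxE /gexp normr0 powR0 ?gt_eqF// mulr0 oppr0 expR0.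
  rewrite negb_forall => /existsP[j nj].
  have -> : dl P = 0 by rewrite /dl (bigD1 j)//= (negbTE nj) mul0r.
  by rewrite mul0r !subr0.
rewrite (_ : _ - Iint f = M%:R ^- s *
   \sum_P (complex.Re (fourier f (xi P)) - dl P * Iint f)); last first.
  rewrite sumrB -mulr_suml sdl mulrBr mulrA mulVf ?mul1r//.
  by rewrite expf_neq0.
rewrite normrM gtr0_norm// ler_pdivrMl ?exprn_gt0 ?ltr0n//.
apply: le_trans (ler_norm_sum _ _ _) _.
apply: (@le_trans _ _ (\sum_P B * (e P - dl P))); first by apply: ler_sum => P _; exact: step.
rewrite -mulr_sumr sumrB sdl mulrCA; apply: ler_wpM2l => //.
by rewrite mulrBr mulr1 lerB.
Qed.

(** * Truncation *)

(** Index of the nearest lattice point, ties going up, so that the cells are half-open and tile the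
    line. *)
Definition cellindex {R : realType} (h x : R) : int := Num.floor (x / h + 2^-1).

Lemma cellindex_eq (R : realType) (h x : R) (k : int) : 0 < h ->
  (cellindex h x == k) = (x \in `[(k%:~R - 2^-1) * h, (k%:~R - 2^-1) * h + h[).
Proof.
move=> h0; rewrite floor_eq in_itv /= intrD; congr (_ && _).
  by rewrite -lerBlDr ler_pdivlMr.
by rewrite -ltrBrDr ltr_pdivrMr//; congr (_ < _); field.
Qed.

Lemma cellindex_box (R : realType) (h x : R) (m : nat) : 0 < h ->
  (x \in `[- halfcell h m, halfcell h m[) = (`|cellindex h x| <= m)%N.
Proof.
move=> h0; have -> : (`|cellindex h x| <= m)%N =
    (- m%:Z <= cellindex h x) && (cellindex h x < m%:Z + 1) by lia.
rewrite floor_ge_int floor_lt_int in_itv /= intrD mulrNz /halfcell; congr (_ && _).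
  by rewrite -lerBlDr ler_pdivlMr//; congr (_ <= _); rewrite -mulNr; congr (_ * _); ring.
by rewrite -ltrBrDr ltr_pdivrMr//; congr (_ < _); congr (_ * _); field.
Qed.

Lemma integral_indic_mul (R : realType) (A : set R) (f : R -> R) : measurable A ->
  (\int[@lebesgue_measure R]_x (\1_A x * f x)%R%:E =
   \int[@lebesgue_measure R]_(x in A) (f x)%:E)%E.
Proof.
move=> mA; rewrite [RHS]integral_mkcond; apply: eq_integral => x _.
by rewrite patchE indicE; case: ifP => _; rewrite ?mul1r ?mul0r.
Qed.

Lemma cellindex_indic (R : realType) (h : R) (k : int) : 0 < h ->
  (fun x => (cellindex h x == k)%:R) =
  \1_(`[(k%:~R - 2^-1) * h, (k%:~R - 2^-1) * h + h[%classic) :> (R -> R).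
Proof. by move=> h0; apply/funext => x; rewrite cellindex_eq// indicE mem_setE. Qed.

Lemma measurable_cellindex (R : realType) (h : R) (k : int) : 0 < h ->
  measurable_fun setT (fun x : R => (cellindex h x == k)%:R : R).
Proof. by move=> h0; rewrite cellindex_indic//; exact: measurable_indic. Qed.

Lemma integral_cell_fejer (R : realType) (h : R) M (k : int) : 0 < h -> (0 < M)%N ->
  (\int[@lebesgue_measure R]_x ((cellindex h x == k)%:R * fejer h M x)%R%:E = h%:E)%E.
Proof.
move=> h0 M0; have := cellindex_indic R h k h0; set A := `[_, _[%classic => e.
transitivity (\int[@lebesgue_measure R]_x (\1_A x * fejer h M x)%R%:E)%E.
  by rewrite -e.
rewrite integral_indic_mul; last exact: measurable_itv.
by have := integral_fejer_itv_co R h ((k%:~R - 2^-1) * h) M 1 h0 M0; rewrite !mul1r.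
Qed.

Lemma natr_doubleS (R : realType) (m : nat) : (m.*2.+1)%:R = 2 * m%:R + 1 :> R.
Proof. by rewrite -addn1 natrD -mul2n natrM. Qed.

Lemma integral_box_fejer (R : realType) (h : R) M m : 0 < h -> (0 < M)%N ->
  (\int[@lebesgue_measure R]_x
     (\1_(`[(- halfcell h m)%R, (halfcell h m)%R[) x * fejer h M x)%R%:E =
   ((m.*2.+1)%:R * h)%R%:E)%E.
Proof.
move=> h0 M0; rewrite integral_indic_mul//.
have e : halfcell h m = - halfcell h m + (m.*2.+1)%:R * h.
  by rewrite /halfcell natr_doubleS; field.
by rewrite [X in `[_, X[]e integral_fejer_itv_co.
Qed.

Lemma integral_box (R : realType) (h : R) m : 0 < h ->
  (\int[@lebesgue_measure R]_x (\1_(`[(- halfcell h m)%R, (halfcell h m)%R[) x)%R%:E =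
   ((m.*2.+1)%:R * h)%R%:E)%E.
Proof.
move=> h0; rewrite integral_indic// setIT /= lebesgue_measure_itv /= lte_fin.
rewrite gtrN; last by apply: mulr_gt0 => //; rewrite ltr_wpDl// invr_gt0.
by rewrite -EFinD; congr _%:E; rewrite /halfcell natr_doubleS; field.
Qed.

(** As [k] is integral, [n / 2] may be rounded down: coordinate [j] has [2 * (n j)./2 + 1] points,
    which is [n j] when [n j] is odd. *)
Lemma in_grid s (n : 'I_s -> nat) (k : 'rV[int]_s) :
  k \in grid n = [forall j, (`|k 0%R j| <= (n j)./2)%N].
Proof.
have e (z : int) (m : nat) : (- (m%:Q / 2) <= z%:Q <= m%:Q / 2) = (`|z| <= m./2)%N.
  rewrite -mulNr ler_pdivrMr// ler_pdivlMr// -[2]/(2%:Q) -intrM -mulrNz !ler_int.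
  by lia.
apply/idP/forallP => [|h]; last by apply/mem_set => j; rewrite e.
by move=> /set_mem h j; rewrite -e.
Qed.

Lemma finite_grid s (n : 'I_s -> nat) : finite_set (grid n).
Proof.
pose L := \max_j n j.
pose v (t : {ffun 'I_s -> 'I_(L.*2.+1)}) : 'rV[int]_s := \row_j ((t j)%:Z - L%:Z).
apply: (@sub_finite_set _ _ (v @` [set: {ffun 'I_s -> 'I_(L.*2.+1)}])); last first.
  exact/finite_image/finite_finset.
move=> k /mem_set; rewrite in_grid => /forallP kn.
have kL j : (`|k 0%R j| <= L)%N.
  by rewrite (leq_trans (kn j))// (leq_trans _ (leq_bigmax j))//; lia.
exists [ffun j => inord `|(k 0 j + L%:Z)%R|%N] => //.
apply/rowP => j; rewrite mxE ffunE inordK; have := kL j; lia.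
Qed.

Lemma cosD2pi_int (R : realType) (t : R) (k : int) : cos (t + 2 * pi * k%:~R) = cos t.
Proof.
have E n : (pi *+ 2 *+ n : R) = 2 * pi * n%:R.
  by rewrite -[in LHS]mulr_natr -[pi *+ 2]mulr_natl.
case: k => n; first by rewrite -(periodicn (@cosD2pi R) n t) E.
rewrite NegzE mulrNz -[in LHS](periodicn (@cosD2pi R) n.+1) E.
by congr cos; ring.
Qed.

Lemma cellindex_dist (R : realType) (h x : R) (k : int) : 0 < h ->
  cellindex h x = k -> `|x - k%:~R * h| <= h / 2.
Proof.
move=> h0 /eqP; rewrite cellindex_eq// in_itv /= => /andP[x1 x2].
rewrite ler_norml; apply/andP; split; move: x1 x2; rewrite mulrBl;
  move: (k%:~R * h) => kh; lra.
Qed.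

Lemma scale_pi_bound (R : realType) (h u : R) : 0 < h -> 0 <= u -> u <= h / 2 ->
  0 <= 2 * pi * (u / h) <= pi.
Proof.
move=> h0 u0 uh; rewrite !mulr_ge0 ?invr_ge0 ?pi_ge0 ?(ltW h0)//=.
apply: (@le_trans _ _ (2 * pi * 2^-1)); last by have := @pi_gt0 R; lra.
by rewrite ler_pM2l ?mulr_gt0 ?pi_gt0// ler_pdivrMr// mulrC.
Qed.

(** Shifted to the node, [1 - cos] is even; as [x] is within [h / 2] of its node and [de <= h / 2],
    both arguments lie in [[0, pi]], where the cosine decreases. *)
Lemma cellindex_near (R : realType) (h x de : R) (k : int) : 0 < h ->
  cellindex h x = k -> 0 < de -> de <= h / 2 ->
  1 - cos (2 * pi * (x / h)) < 1 - cos (2 * pi * (de / h)) -> `|x - k%:~R * h| < de.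
Proof.
move=> h0 xk de0 deh; have := cellindex_dist R h x k h0 xk.
set t := x - _ => th; rewrite ltrD2l ltrN2.
have -> : 2 * pi * (x / h) = 2 * pi * (t / h) + 2 * pi * k%:~R.
  by rewrite /t; field; rewrite gt_eqF.
rewrite cosD2pi_int => lt; rewrite ltNge; apply/negP => det.
move: lt; apply/negP; rewrite -leNgt -[cos (_ * (t / h))]cos_norm.
have bnd (u : R) : 0 <= u -> u <= h / 2 -> 2 * pi * (u / h) \in `[0, pi].
  by move=> u0 uh; rewrite in_itv /= scale_pi_bound.
have -> : `|2 * pi * (t / h)| = 2 * pi * (`|t| / h).
  by rewrite !normrM normfV (gtr0_norm h0) (gtr0_norm (@pi_gt0 R)) ger0_norm.
rewrite leNgt ltr_cos ?bnd ?(ltW de0)// -leNgt.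
by rewrite ler_pM2l ?mulr_gt0 ?pi_gt0// ler_pM2r ?invr_gt0.
Qed.

Lemma cos_scale_lt1 (R : realType) (h de : R) : 0 < h -> 0 < de -> de <= h / 2 ->
  0 < 1 - cos (2 * pi * (de / h)).
Proof.
move=> h0 de0 deh; rewrite subr_gt0 -[ltRHS](@cos0 R) ltr_cos ?in_itv /= ?lexx ?pi_ge0//.
  by rewrite !mulr_gt0 ?invr_gt0 ?pi_gt0.
by rewrite scale_pi_bound// ltW.
Qed.

Lemma integral_prod_rV_le (R : realType) n (F : 'I_n -> R -> R) (q : 'I_n -> R) :
  (forall i, measurable_fun setT (F i)) -> (forall i x, 0 <= F i x) ->
  (forall i, \int[@lebesgue_measure R]_x (F i x)%:E <= (q i)%:E)%E ->
  (\int[lebesgue_rV n]_v (\prod_i F i (v 0 i))%:E <= (\prod_i q i)%:E)%E.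
Proof.
move=> mF F0 Fq; rewrite ge0_integral_prod_rV// -prodEFin.
have I0 i : (0 <= \int[@lebesgue_measure R]_x (F i x)%:E)%E.
  by apply: integral_ge0 => x _; rewrite lee_fin.
have [] // : (0 <= \prod_i \int[@lebesgue_measure R]_x (F i x)%:E /\
  \prod_i \int[@lebesgue_measure R]_x (F i x)%:E <= \prod_i (q i)%:E)%E.
apply: (big_ind2 (fun x y : \bar R => (0 <= x /\ x <= y)%E)) => //.
by move=> x1 x2 y1 y2 [? ?] [? ?]; split; [exact: mule_ge0|exact: lee_pmul].
Qed.

Definition cell_rV {R : realType} {s : nat} (h : 'I_s -> R) (x : 'rV[R]_s) : 'rV[int]_s :=
  \row_j cellindex (h j) (x 0 j).

Definition node {R : realType} {s : nat} (h : 'I_s -> R) (k : 'rV[int]_s) : 'rV[R]_s :=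
  \row_j ((k 0 j)%:~R * h j).

(** Nearness is measured by [1 - cos], the quantity in which the kernel decays. Induction on the
    list of nodes yields one threshold for all of them. *)
Lemma continuous_grid (R : realType) s (h : 'I_s -> R) (f : 'rV[R]_s -> R)
    (r : seq 'rV[int]_s) (ep : R) :
  (forall j, 0 < h j) -> continuous f -> 0 < ep ->
  exists2 de, 0 < de & forall x : 'rV[R]_s,
    cell_rV h x \in r ->
    (forall j, 1 - cos (2 * pi * (x 0 j / h j)) < de) ->
    `|f x - f (node h (cell_rV h x))| <= ep.
Proof.
move=> h0 cf ep0; elim: r => [|k r [de de0 IH]]; first by exists 1.
have /cvgrPdist_le/(_ ep ep0)/nbhs_ballP[e /= e0 fe] := cf (node h k).
(* Close to 0 from the right finitely many upper bounds hold at once, which avoids forming a minimum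
   over the coordinates. *)
have [d d0 dP] : exists2 d, 0 < d & d < e /\ forall j, d <= h j / 2.
  have : \forall d \near 0^'+, 0 < d /\ (d < e /\ forall j, d <= h j / 2).
    near=> d; split; [by []|split].
      by near: d; exact: nbhs_right_lt.
    by near: d; apply: filter_forall => j; apply: nbhs_right_le; rewrite divr_gt0.
  by move=> /filter_ex[d [d0 dP]]; exists d.
have [de' de'0 de'P] : exists2 de', 0 < de' & de' <= de /\
    forall j, de' <= 1 - cos (2 * pi * (d / h j)).
  have : \forall u \near 0^'+, 0 < u /\ (u <= de /\
      forall j, u <= 1 - cos (2 * pi * (d / h j))).
    near=> u; split; [by []|split].
      by near: u; exact: nbhs_right_le.
    near: u; apply: filter_forall => j; apply: nbhs_right_le.
    by apply: cos_scale_lt1 => //; exact: (dP.2 j).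
  by move=> /filter_ex[u [u0 uP]]; exists u.
exists de' => // x; rewrite inE => /predU1P[xk|xr] xde; last first.
  by apply: IH => // j; apply: lt_le_trans (xde j) de'P.1.
have ck j : cellindex (h j) (x 0 j) = k 0 j by rewrite -xk mxE.
rewrite xk distrC; apply: fe; split => // i j; rewrite (ord1 i) mxE.
rewrite /ball /= distrC; apply: lt_trans dP.1.
apply: (cellindex_near _ _ _ _ _ (h0 j) (ck j) d0 (dP.2 j)).
exact: lt_le_trans (xde j) (de'P.2 j).
Unshelve. all: by end_near. Qed.

(** * The kernel and the step function in several variables *)

Definition kernel_rV {R : realType} {s : nat} (h : 'I_s -> R) (M : nat) (x : 'rV[R]_s) : R :=
  \prod_j fejer (h j) M (x 0 j).

Definition step_fun {R : realType} {s : nat} (h : 'I_s -> R) (n : 'I_s -> nat)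
    (f : 'rV[R]_s -> R) (x : 'rV[R]_s) : R :=
  \sum_(k <- fset_set (grid n)) f (node h k) * (cell_rV h x == k)%:R.

Lemma step_funE (R : realType) s (h : 'I_s -> R) (n : 'I_s -> nat)
    (f : 'rV[R]_s -> R) (x : 'rV[R]_s) :
  step_fun h n f x = if cell_rV h x \in grid n then f (node h (cell_rV h x)) else 0.
Proof.
rewrite /step_fun; case: ifPn => xg.
  rewrite (bigD1_seq (cell_rV h x)) ?fset_uniq ?in_fset_set//=; last exact: finite_grid.
  rewrite eqxx mulr1 big1 ?addr0// => k.
  by rewrite eq_sym => /negbTE ->; rewrite mulr0.
rewrite big_seq big1// => k; rewrite in_fset_set; last exact: finite_grid.
by case: eqP => [<-|]; rewrite ?(negbTE xg)// mulr0.
Qed.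

Lemma kernel_rV_ge0 (R : realType) s (h : 'I_s -> R) M x : 0 <= kernel_rV h M x.
Proof. by rewrite prodr_ge0// => j _; exact: fejer_ge0. Qed.

Lemma kernel_rV_le (R : realType) s (h : 'I_s -> R) M x : `|kernel_rV h M x| <= M%:R ^+ s.
Proof.
rewrite ger0_norm ?kernel_rV_ge0// -[s in leRHS](card_ord s) -prodr_const.
by apply: ler_prod => j _; rewrite fejer_ge0 fejer_le.
Qed.

Lemma measurable_kernel_rV (R : realType) s (h : 'I_s -> R) M :
  measurable_fun setT (kernel_rV h M).
Proof.
by apply: (measurable_prod_rV _ _ (fun j => fejer (h j) M)) => j; exact: measurable_fejer.
Qed.

Lemma cell_rV_kernel (R : realType) s (h : 'I_s -> R) M (k : 'rV[int]_s) (x : 'rV[R]_s) :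
  (cell_rV h x == k)%:R * kernel_rV h M x =
  \prod_j ((cellindex (h j) (x 0 j) == k 0 j)%:R * fejer (h j) M (x 0 j)).
Proof.
rewrite big_split /=; congr (_ * _).
have [<-|nk] := eqVneq (cell_rV h x) k.
  by rewrite big1// => j _; rewrite mxE eqxx.
have : ~~ [forall j, cellindex (h j) (x 0 j) == k 0 j].
  apply: contra nk => /forallP e; apply/eqP/rowP => j.
  by rewrite mxE; apply/eqP; exact: e.
rewrite negb_forall => /existsP[j nj].
by rewrite (bigD1 j)//= (negbTE nj) mul0r.
Qed.

Lemma integral_cell_kernel (R : realType) s (h : 'I_s -> R) M (k : 'rV[int]_s) :
  (forall j, 0 < h j) -> (0 < M)%N ->
  (\int[lebesgue_rV s]_x ((cell_rV h x == k)%:R * kernel_rV h M x)%R%:E =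
   (\prod_j h j)%:E)%E.
Proof.
move=> h0 M0; under eq_integral do rewrite cell_rV_kernel.
rewrite (ge0_integral_prod_rV _ _ (fun j t =>
  (cellindex (h j) t == k 0 j)%:R * fejer (h j) M t)).
- by rewrite -prodEFin; apply: eq_bigr => j _; rewrite integral_cell_fejer.
- move=> j; apply: measurable_funM; [exact: measurable_cellindex|exact: measurable_fejer].
- by move=> j t; rewrite mulr_ge0 ?fejer_ge0.
Qed.

Lemma measurable_cell_kernel (R : realType) s (h : 'I_s -> R) M (k : 'rV[int]_s) :
  (forall j, 0 < h j) ->
  measurable_fun setT (fun x : 'rV[R]_s => (cell_rV h x == k)%:R * kernel_rV h M x).
Proof.
move=> h0.
rewrite (_ : (fun x => _) = (fun x : 'rV[R]_s =>
   \prod_j ((cellindex (h j) (x 0 j) == k 0 j)%:R * fejer (h j) M (x 0 j)))); last first.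
  by apply/funext => x; exact: cell_rV_kernel.
apply: (measurable_prod_rV _ _ (fun j t =>
  (cellindex (h j) t == k 0 j)%:R * fejer (h j) M t)) => j.
by apply: measurable_funM; [exact: measurable_cellindex|exact: measurable_fejer].
Qed.

Lemma integrable_cell_kernel (R : realType) s (h : 'I_s -> R) M (k : 'rV[int]_s) :
  (forall j, 0 < h j) -> (0 < M)%N ->
  (lebesgue_rV s).-integrable setT
    (EFin \o (fun x => (cell_rV h x == k)%:R * kernel_rV h M x)).
Proof.
move=> h0 M0; apply/integrableP; split.
  by apply/measurable_EFinP; exact: measurable_cell_kernel.
under eq_integral do rewrite /= ger0_norm ?mulr_ge0 ?kernel_rV_ge0//.
by rewrite integral_cell_kernel// ltry.
Qed.

Lemma step_fun_kernelE (R : realType) s (h : 'I_s -> R) n (f : 'rV[R]_s -> R) M x :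
  step_fun h n f x * kernel_rV h M x = \sum_(k <- fset_set (grid n))
     f (node h k) * ((cell_rV h x == k)%:R * kernel_rV h M x).
Proof. by rewrite /step_fun mulr_suml; apply: eq_bigr => k _; rewrite mulrA. Qed.

Lemma integrable_step_fun (R : realType) s (h : 'I_s -> R) n (f : 'rV[R]_s -> R) M :
  (forall j, 0 < h j) -> (0 < M)%N ->
  (lebesgue_rV s).-integrable setT
    (EFin \o (fun x => step_fun h n f x * kernel_rV h M x)).
Proof.
move=> h0 M0.
rewrite (_ : EFin \o _ = (fun x => \sum_(k <- fset_set (grid n))
  ((f (node h k))%:E * (EFin \o (fun x => (cell_rV h x == k)%:R * kernel_rV h M x)%R) x))%E).
  apply: integrable_sum => // k _; apply: integrableZl => //.
  exact: integrable_cell_kernel.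
by apply/funext => x /=; rewrite step_fun_kernelE -sumEFin.
Qed.

(** The kernel has mass [h_1 ... h_s] on every cell, whatever its degree, so the node values
    reproduce the rule exactly and the whole error lies in [f - step_fun]. *)
Lemma Rintegral_step_fun (R : realType) s (h : 'I_s -> R) n (f : 'rV[R]_s -> R) M :
  (forall j, 0 < h j) -> (0 < M)%N ->
  Rintegral (lebesgue_rV s) setT (fun x => step_fun h n f x * kernel_rV h M x) = Qrule h n f.
Proof.
move=> h0 M0.
transitivity (Rintegral (lebesgue_rV s) setT (fun x => \sum_(k <- fset_set (grid n))
     f (node h k) * ((cell_rV h x == k)%:R * kernel_rV h M x))).
  by apply: eq_Rintegral => x _; exact: step_fun_kernelE.
rewrite Rintegral_sum; last first.
  move=> k; rewrite (_ : EFin \o _ = (fun x =>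
  ((f (node h k))%:E * (EFin \o (fun x => (cell_rV h x == k)%:R * kernel_rV h M x)%R) x))%E)//.
  by apply: integrableZl => //; exact: integrable_cell_kernel.
rewrite /Qrule fsbig_finite; last exact: finite_grid.
rewrite mulr_sumr; apply: eq_bigr => k _.
rewrite RintegralZl//; last exact: integrable_cell_kernel.
by rewrite /Rintegral integral_cell_kernel//= mulrC.
Qed.

(* The weight [exp (- c |x|^d)] integrated against the kernel: the [j]-th factor
   over the complement of the box, the other ones over the whole line. *)
Definition tail_factor {R : realType} {s : nat} (c d h : 'I_s -> R) (n : 'I_s -> nat)
    (j i : 'I_s) : R :=
  let G := Gammaf (d i)^-1 / (d i * c i `^ (d i)^-1) in
  if i == j then 2 * gexp (c i) (d i) (halfcell (h i) (n i)./2) * (h i + G)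
  else 3 * h i + 2 * G.

Section step_error.
Context (R : realType) (s : nat) (c d h : 'I_s -> R) (n : 'I_s -> nat) (M : nat)
  (c0 : forall j, 0 < c j) (d1 : forall j, 1 <= d j) (h0 : forall j, 0 < h j)
  (M0 : (0 < M)%N).

Let box j : set R := `[- halfcell (h j) (n j)./2, halfcell (h j) (n j)./2[%classic.

(** Factors of three product majorants. In [mixed j] the kernel is missing in coordinate [j], where
    a constant will bound it; [outer j] has coordinate [j] outside the box and the decay of [f] in
    all coordinates. *)
Let inner i t : R := \1_(box i) t * fejer (h i) M t.
Let mixed j i t : R := if i == j then \1_(box i) t else inner i t.
Let outer j i t : R :=
  (if i == j then \1_(~` box i) t * gexp (c i) (d i) t else gexp (c i) (d i) t) *
  fejer (h i) M t.

Let V : R := \prod_j (((n j)./2.*2.+1)%:R * h j).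

Let mbox j : measurable (box j). Proof. exact: measurable_itv. Qed.

Let minner i : measurable_fun setT (inner i).
Proof. by apply: measurable_funM; [exact: measurable_indic|exact: measurable_fejer]. Qed.

Let inner_ge0 i t : 0 <= inner i t.
Proof. by rewrite mulr_ge0 ?fejer_ge0. Qed.

Let mmixed j i : measurable_fun setT (mixed j i).
Proof. by rewrite /mixed; case: eqP => _; [exact: measurable_indic|exact: minner]. Qed.

Let mixed_ge0 j i t : 0 <= mixed j i t.
Proof. by rewrite /mixed; case: eqP. Qed.

Let mouter j i : measurable_fun setT (outer j i).
Proof.
apply: measurable_funM; last exact: measurable_fejer.
case: eqP => _; last exact: measurable_gexp.
apply: measurable_funM; last exact: measurable_gexp.
by apply: measurable_indic; exact: measurableC.
Qed.

Let outer_ge0 j i t : 0 <= outer j i t.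
Proof. by rewrite mulr_ge0 ?fejer_ge0//; case: eqP => _; rewrite ?mulr_ge0 ?gexp_ge0. Qed.

Lemma integral_inner : (\int[lebesgue_rV s]_x (\prod_i inner i (x 0%R i))%:E <= V%:E)%E.
Proof.
apply: integral_prod_rV_le => // i.
by rewrite integral_box_fejer.
Qed.

Lemma integral_mixed j : (\int[lebesgue_rV s]_x (\prod_i mixed j i (x 0%R i))%:E <= V%:E)%E.
Proof.
apply: integral_prod_rV_le => // i; rewrite /mixed; case: eqP => _.
  by rewrite integral_box.
by rewrite integral_box_fejer.
Qed.

Lemma integral_outer j :
  (\int[lebesgue_rV s]_x (\prod_i outer j i (x 0%R i))%:E <=
   (\prod_i tail_factor c d h n j i)%:E)%E.
Proof.
apply: integral_prod_rV_le => // i; rewrite /outer /tail_factor; case: eqP => _.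
  exact: integral_gexp_fejer_out.
exact: integral_gexp_fejer.
Qed.

Context (f : 'rV[R]_s -> R) (B ep de : R)
  (B0 : 0 <= B) (ep0 : 0 <= ep) (de0 : 0 < de)
  (fB : forall x, `|f x| <= B * \prod_j gexp (c j) (d j) (x 0 j))
  (fde : forall x, cell_rV h x \in grid n ->
    (forall j, 1 - cos (2 * pi * (x 0 j / h j)) < de) ->
    `|f x - f (node h (cell_rV h x))| <= ep).

Let C : R := 2 * B * (2 / M%:R / de).
(* On the box, [ep] bounds [f - step_fun] near the nodes, and away from them the
   kernel has a factor at most [2 / M / de]; outside the box the decay of [f]
   takes over. *)
Let H (x : 'rV[R]_s) : R := ep * \prod_i inner i (x 0 i) +
  C * (\sum_j \prod_i mixed j i (x 0 i)) + B * (\sum_j \prod_i outer j i (x 0 i)).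

Let C0 : 0 <= C.
Proof. by rewrite !mulr_ge0 ?invr_ge0 ?(ltW de0). Qed.

Let fB1 x : `|f x| <= B.
Proof.
apply: le_trans (fB x) _; rewrite ler_piMr// prodr_ile1// => j _.
by rewrite gexp_ge0 gexp_le1// ltW.
Qed.

Lemma step_fun_dominated x :
  `|f x * kernel_rV h M x - step_fun h n f x * kernel_rV h M x| <= H x.
Proof.
rewrite /H -mulrBl normrM (ger0_norm (kernel_rV_ge0 _ _ _ _ _)) step_funE.
have pin0 (F : 'I_s -> R -> R) : (forall i t, 0 <= F i t) -> 0 <= \prod_i F i (x 0 i).
  by move=> F0; apply: prodr_ge0.
have S1 : 0 <= \sum_j \prod_i mixed j i (x 0 i).
  by apply: sumr_ge0 => j _; exact: pin0.
have S2 : 0 <= \sum_j \prod_i outer j i (x 0 i).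
  by apply: sumr_ge0 => j _; exact: pin0.
case: ifPn => [xg|].
  have xb i : x 0 i \in `[- halfcell (h i) (n i)./2, halfcell (h i) (n i)./2[.
    by rewrite cellindex_box//; move: xg; rewrite in_grid => /forallP/(_ i); rewrite mxE.
  have b1 i : \1_(box i) (x 0 i) = 1 :> R.
    by rewrite indicE mem_set//; exact: xb.
  have [/forallP xde|] := boolP [forall j, 1 - cos (2 * pi * (x 0 j / h j)) < de].
    apply: (@le_trans _ _ (ep * \prod_i inner i (x 0 i))); last first.
      by rewrite -addrA lerDl addr_ge0// mulr_ge0.
    rewrite [X in _ <= ep * X](_ : _ = kernel_rV h M x).
      by rewrite ler_wpM2r ?kernel_rV_ge0// fde.
    by apply: eq_bigr => i _; rewrite /inner b1 mul1r.
  rewrite negb_forall => /existsP[j]; rewrite -leNgt => xj.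
  apply: (@le_trans _ _ (C * \prod_i mixed j i (x 0 i))); last first.
    apply: (@le_trans _ _ (C * \sum_j \prod_i mixed j i (x 0 i))).
      apply: ler_wpM2l => //; rewrite [leRHS](bigD1 j)//= lerDl.
      by apply: sumr_ge0 => k _; exact: pin0.
    by rewrite addrAC lerDr addr_ge0// mulr_ge0// pin0.
  (* The [j]-th kernel factor is split off to be bounded by its decay; the other factors agree with
     those of [mixed j]. *)
  rewrite /kernel_rV (bigD1 j)//= [X in _ <= _ * X](bigD1 j)//= {1}/mixed eqxx b1 mul1r.
  rewrite [X in _ <= _ * X](_ : _ = \prod_(i | i != j) fejer (h i) M (x 0 i)); last first.
    by apply: eq_bigr => i /negbTE ij; rewrite /mixed ij /inner b1 mul1r.
  rewrite mulrA ler_wpM2r//; first by apply: prodr_ge0 => i _; exact: fejer_ge0.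
  apply: ler_pM; rewrite ?fejer_ge0//.
    by apply: le_trans (ler_normB _ _) _; have := fB1 x;
      have := fB1 (node h (cell_rV h x)); lra.
  rewrite ler_pdivlMr//; apply: le_trans (fejer_decay R (h j) M (x 0 j) M0).
  by rewrite mulrC ler_wpM2r ?fejer_ge0.
rewrite in_grid negb_forall => /existsP[j]; rewrite mxE => xj; rewrite subr0.
apply: (@le_trans _ _ (B * \prod_i outer j i (x 0 i))); last first.
  apply: (@le_trans _ _ (B * \sum_j \prod_i outer j i (x 0 i))).
    apply: ler_wpM2l => //; rewrite [leRHS](bigD1 j)//= lerDl.
      by apply: sumr_ge0 => k _; exact: pin0.
  by rewrite lerDr addr_ge0// mulr_ge0// pin0.
have -> : \prod_i outer j i (x 0 i) =
    (\prod_i gexp (c i) (d i) (x 0 i)) * kernel_rV h M x.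
  rewrite -big_split /=; apply: eq_bigr => i _; rewrite /outer; case: eqP => // ->.
  rewrite indicE mem_set ?mul1r// => /= bx.
  by move: xj; rewrite -cellindex_box// bx.
by rewrite mulrA ler_wpM2r ?kernel_rV_ge0.
Qed.

(** The rule is itself an integral against the kernel, so the error is the integral of a difference,
    dominated by [H]; each summand of [H] factors over the coordinates. *)
Lemma step_error : (lebesgue_rV s).-integrable setT (EFin \o f) ->
  `|Rintegral (lebesgue_rV s) setT (fun x => f x * kernel_rV h M x) - Qrule h n f| <=
  ep * V + C * (s%:R * V) + B * \sum_j \prod_i tail_factor c d h n j i.
Proof.
move=> fi; rewrite -(Rintegral_step_fun R s h n f M)//.
have fKi : (lebesgue_rV s).-integrable setT (EFin \o (fun x => f x * kernel_rV h M x)).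
  apply: (integrable_mul_bounded _ _ _ _ _ _ (M%:R ^+ s)) => //.
    exact: measurable_kernel_rV.
  exact: kernel_rV_le.
have sKi := integrable_step_fun R s h n f M h0 M0.
rewrite -RintegralB//.
have di : (lebesgue_rV s).-integrable setT
    (EFin \o (fun x => f x * kernel_rV h M x - step_fun h n f x * kernel_rV h M x)).
  exact: (integrableB measurableT fKi sKi).
rewrite -lee_fin EFin_normr_Rintegral//.
have md := measurable_int _ di.
apply: le_trans (le_abse_integral _ measurableT md) _.
pose mp (F : 'I_s -> R -> R) (mF : forall i, measurable_fun setT (F i)) :=
  measurable_prod_rV R s F mF.
have mi : measurable_fun setT (fun x : 'rV[R]_s => (\prod_i inner i (x 0 i))%:E).
  by apply/measurable_EFinP; exact: mp.
have mm j : measurable_fun setT (fun x : 'rV[R]_s => (\prod_i mixed j i (x 0 i))%:E).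
  by apply/measurable_EFinP; exact: mp.
have mo j : measurable_fun setT (fun x : 'rV[R]_s => (\prod_i outer j i (x 0 i))%:E).
  by apply/measurable_EFinP; exact: mp.
have i0 (x : 'rV[R]_s) : (0 <= (\prod_i inner i (x 0%R i))%:E)%E.
  by rewrite lee_fin; apply: prodr_ge0.
have m0 j (x : 'rV[R]_s) : (0 <= (\prod_i mixed j i (x 0%R i))%:E)%E.
  by rewrite lee_fin; apply: prodr_ge0.
have o0 j (x : 'rV[R]_s) : (0 <= (\prod_i outer j i (x 0%R i))%:E)%E.
  by rewrite lee_fin; apply: prodr_ge0.
have s1 (x : 'rV[R]_s) : (0 <= \sum_j (\prod_i mixed j i (x 0%R i))%:E)%E.
  by apply: sume_ge0 => j _; exact: m0.
have s2 (x : 'rV[R]_s) : (0 <= \sum_j (\prod_i outer j i (x 0%R i))%:E)%E.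
  by apply: sume_ge0 => j _; exact: o0.
have ms1 : measurable_fun setT
    (fun x : 'rV[R]_s => (\sum_j (\prod_i mixed j i (x 0%R i))%:E)%E).
  exact: emeasurable_sum.
have ms2 : measurable_fun setT
    (fun x : 'rV[R]_s => (\sum_j (\prod_i outer j i (x 0%R i))%:E)%E).
  exact: emeasurable_sum.
have epE : (0 <= ep%:E)%E by rewrite lee_fin.
have CE : (0 <= C%:E)%E by rewrite lee_fin.
have BE : (0 <= B%:E)%E by rewrite lee_fin.
have e1 (x : 'rV[R]_s) : (0 <= ep%:E * (\prod_i inner i (x 0%R i))%:E)%E.
  exact: mule_ge0.
have e2 (x : 'rV[R]_s) : (0 <= C%:E * \sum_j (\prod_i mixed j i (x 0%R i))%:E)%E.
  exact: mule_ge0.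
have e3 (x : 'rV[R]_s) : (0 <= B%:E * \sum_j (\prod_i outer j i (x 0%R i))%:E)%E.
  exact: mule_ge0.
apply: (@le_trans _ _ (\int[lebesgue_rV s]_x
  (ep%:E * (\prod_i inner i (x 0%R i))%:E +
   C%:E * (\sum_j (\prod_i mixed j i (x 0%R i))%:E) +
   B%:E * (\sum_j (\prod_i outer j i (x 0%R i))%:E)))%E).
  apply: ge0_le_integral => //.
  - exact: measurableT_comp.
  - by apply: emeasurable_funD; first apply: emeasurable_funD; apply: measurable_funeM.
  - by move=> x _; rewrite !sumEFin -!EFinM -!EFinD lee_fin; exact: step_fun_dominated.
rewrite ge0_integralD//; last 3 first.
- by move=> x _; rewrite adde_ge0.
- by apply: emeasurable_funD; apply: measurable_funeM.
- exact: measurable_funeM.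
rewrite ge0_integralD//; last 2 first.
- exact: measurable_funeM.
- exact: measurable_funeM.
rewrite !ge0_integralZl_EFin//.
rewrite !ge0_integral_sum// !EFinD.
apply: leeD; first apply: leeD.
- by rewrite [leRHS]EFinM; apply: lee_wpmul2l => //; exact: integral_inner.
- rewrite [leRHS]EFinM; apply: lee_wpmul2l; first by rewrite lee_fin.
  rewrite (_ : s%:R * V = \sum_(j < s) V); last by rewrite sumr_const card_ord mulr_natl.
  by rewrite -sumEFin; apply: lee_sum => j _; exact: integral_mixed.
- rewrite [leRHS]EFinM; apply: lee_wpmul2l; first by rewrite lee_fin.
  rewrite -sumEFin; apply: lee_sum => j _; exact: integral_outer.
Qed.

End step_error.

(** Neither side of the estimate involves the kernel. Given a tolerance [e], first [ep], then [de],
    then the degree [M] are chosen so that the two terms depending on them are at most [e / 2]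
    each. *)
Lemma trapezoidal_error (R : realType) s (a b c d h th : 'I_s -> R) (n : 'I_s -> nat)
    (f : 'rV[R]_s -> R) (B1 B2 : R) :
  (forall j, 0 < b j) -> (forall j, 0 < c j) -> (forall j, 1 <= d j) ->
  (forall j, 0 < h j) -> 0 <= B1 -> 0 <= B2 ->
  continuous f -> (lebesgue_rV s).-integrable setT (EFin \o f) ->
  (forall x, `|f x| <= B1 * \prod_j gexp (c j) (d j) (x 0 j)) ->
  (forall xi, `|complex.Re (fourier f xi)| <= B2 * \prod_j gexp (a j) (b j) (xi 0 j)) ->
  (forall j m, \sum_(k < m) gexp (a j) (b j) (k.+1%:R / h j) <= th j) ->
  `|Iint f - Qrule h n f| <=
  B2 * (\prod_j (1 + 2 * th j) - 1) + B1 * \sum_j \prod_i tail_factor c d h n j i.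
Proof.
move=> b0 c0 d1 h0 B10 B20 cf fi fB1 fB2 thP.
apply/ler_addgt0Pr => e e0.
pose V : R := \prod_j (((n j)./2.*2.+1)%:R * h j).
have V0 : 0 <= V by apply: prodr_ge0 => j _; rewrite mulr_ge0// ltW.
pose ep := e / 2 / (V + 1).
have V1 : 0 < V + 1 by rewrite ltr_wpDl.
have ep0 : 0 < ep by rewrite !divr_gt0.
have [de de0 deP] := continuous_grid R s h f (fset_set (grid n)) ep h0 cf ep0.
(* Chosen so that the term from points far from the nodes equals [u * (e / 2) / M]; any [M > u] will
   do. *)
pose u := 8 * B1 * s%:R * V / (de * e).
pose M := (Num.truncn u).+1.
have M0 : (0 < M)%N by [].
have uM : u < M%:R by exact: truncnS_gt.
have := alias_bound R s a b h th f B2 M M0 b0 B20 fi fB2 thP.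
have := step_error R s c d h n M c0 d1 h0 M0 f B1 ep de B10 (ltW ep0) de0 fB1 _ fi.
move=> se ab.
have {}se : `|Rintegral (lebesgue_rV s) setT (fun x => f x * kernel_rV h M x) - Qrule h n f| <=
    ep * V + 2 * B1 * (2 / M%:R / de) * (s%:R * V) +
    B1 * \sum_j \prod_i tail_factor c d h n j i.
  apply: se => x xg xde; apply: deP => //.
  by rewrite in_fset_set//; exact: finite_grid.
have epV : ep * V <= e / 2.
  by rewrite /ep mulrAC -mulrA ler_piMr ?divr_ge0 ?(ltW e0)// ler_pdivrMr// mul1r lerDl.
have CV : 2 * B1 * (2 / M%:R / de) * (s%:R * V) <= e / 2.
  have MR : 0 < M%:R :> R by rewrite ltr0n.
  rewrite [leLHS](_ : _ = u * (e / 2) / M%:R); last by rewrite /u; field; rewrite !gt_eqF.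
  by rewrite ler_pdivrMr// mulrC ler_wpM2l ?divr_ge0 ?(ltW e0)// ltW.
move: ab; rewrite distrC => ab.
rewrite (_ : Iint f - _ =
  (Iint f - Rintegral (lebesgue_rV s) setT (fun x => f x * kernel_rV h M x)) +
  (Rintegral (lebesgue_rV s) setT (fun x => f x * kernel_rV h M x) - Qrule h n f));
  last by ring.
apply: le_trans (ler_normD _ _) (le_trans (lerD ab se) _).
by move: epV CV; lra.
Qed.

(** * The parameters *)

(** A finite nonempty family attains its infimum, which is therefore positive. *)
Lemma inf_range_finite (R : realType) s (F : 'I_s -> R) : (0 < s)%N ->
  (forall j, 0 < F j) -> 0 < inf (range F) /\ forall j, inf (range F) <= F j.
Proof.
case: s F => // s F _ F0.
have lb : has_lbound (range F) by exists 0 => _ [j _ <-]; exact: ltW.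
split; last by move=> j; apply: ge_inf => //; exists j.
apply: (@lt_le_trans _ _ (F [arg min_(i < ord0) F i]%O)); first exact: F0.
apply: lb_le_inf; first by exists (F ord0), ord0.
by move=> _ [j _ <-]; case: arg_minP => // i _; exact.
Qed.

Lemma prod_powR (R : realType) (I : Type) (r : seq I) (x : R) (e : I -> R) : 0 < x ->
  \prod_(i <- r) x `^ (e i) = x `^ (\sum_(i <- r) e i).
Proof.
move=> x0; apply/esym; apply: (big_morph (fun t => x `^ t)); last exact: powRr0.
by move=> t u; rewrite powRD// (gt_eqF x0) implybT.
Qed.

(** The product is expanded over subsets [u]: the empty one cancels the 1, and for the others
    [q ^+ #|u| <= q] since [q <= 1]. *)
Lemma alias_factor_le (R : realType) s (q : R) (G : 'I_s -> R) :
  0 <= q -> q <= 1 -> (forall j, 0 <= G j) ->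
  \prod_j (1 + q * G j) - 1 <=
  q * \sum_(u : {set 'I_s} | u != finset.set0) \prod_(j in u) G j.
Proof.
move=> q0 q1 G0.
under eq_bigr do rewrite addrC.
rewrite bigA_distr (bigD1 finset.set0)//= [X in X + _ - _]big1; last first.
  by move=> j _; rewrite finset.inE.
rewrite addrC addKr mulr_sumr; apply: ler_sum => u u0.
rewrite -big_mkcond /= big_split /= ler_wpM2r ?prodr_ge0//.
rewrite prodr_const; have : (0 < #|u|)%N by rewrite finset.card_gt0.
by case: #|u| => // k _; rewrite exprS ler_piMr// exprn_ile1.
Qed.

Section parameters.
Context (R : realType) (s : nat) (hs : (0 < s)%N) (a b c d : 'I_s -> R)
  (ha : forall j, 0 < a j) (hb : forall j, 0 < b j)
  (hc : forall j, 0 < c j) (hd : forall j, 1 <= d j).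

Let d0 j : 0 < d j. Proof. exact: lt_le_trans ltr01 (hd j). Qed.
Local Notation B := (suminv b).
Local Notation D := (suminv d).
Local Notation Cj := (Cc a b c d).
Local Notation Cst := (Cstar a b c d).
Local Notation Csh := (Csharp a b c d).

Let j0 : 'I_s := Ordinal hs.

Lemma suminv_gt0 : 0 < B + D.
Proof.
rewrite /suminv -big_split (bigD1 j0)//= ltr_wpDr ?addr_gt0 ?invr_gt0//.
by apply: sumr_ge0 => j _; rewrite addr_ge0// invr_ge0 ltW.
Qed.

Lemma Cc_gt0 j : 0 < Cj j.
Proof. by rewrite divr_gt0 ?mulr_gt0 ?powR_gt0. Qed.

Lemma Cstar_gt0 : 0 < Cst.
Proof. by have [] := inf_range_finite R s Cj hs Cc_gt0. Qed.

Lemma Cstar_le j : Cst <= Cj j.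
Proof. by have [_] := inf_range_finite R s Cj hs Cc_gt0; exact. Qed.

Let Cst2_gt0 j : 0 < (Cst / 2) `^ d j.
Proof. by rewrite powR_gt0 ?divr_gt0 ?Cstar_gt0. Qed.

Lemma Csharp_gt0 : 0 < Csh.
Proof. by have [] := inf_range_finite R s _ hs Cst2_gt0. Qed.

Lemma Csharp_le j : Csh <= (Cst / 2) `^ d j.
Proof. by have [_] := inf_range_finite R s _ hs Cst2_gt0; exact. Qed.

(** The exponent in the error bound, and the reciprocal of [hpar]: the natural large parameter in
    place of [N]. *)
Definition rate (N : nat) : R := N%:R `^ (B + D)^-1 * Csh `^ (D / (B + D)).

Lemma rate_gt0 N : (0 < N)%N -> 0 < rate N.
Proof. by move=> N0; rewrite mulr_gt0 ?powR_gt0 ?Csharp_gt0 ?ltr0n. Qed.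

Lemma hparE N : hpar a b c d N = (rate N)^-1.
Proof. by rewrite /hpar /rate !powRN invfM. Qed.

(** Source of the threshold on [N]: each largeness condition is a lower bound on [rate N] by a
    constant independent of [f]. *)
Lemma rate_large (K : R) : 0 < K ->
  exists N0, forall N, (N0 <= N)%N -> (0 < N)%N /\ K <= rate N.
Proof.
move=> K0; have S0 := suminv_gt0.
pose u := (K / Csh `^ (D / (B + D))) `^ (B + D).
exists (Num.truncn u).+1 => N uN; split; first exact: leq_trans uN.
have NR : u <= N%:R by rewrite (le_trans (ltW (truncnS_gt _)))// ler_nat.
rewrite /rate -ler_pdivrMr ?powR_gt0 ?Csharp_gt0//.
have K1 : 0 <= K / Csh `^ (D / (B + D)) by rewrite divr_ge0 ?powR_ge0 ?(ltW K0).
rewrite -[leLHS](powRr1 K1) -[X in _ `^ X <= _](@divff _ (B + D)) ?gt_eqF//.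
rewrite (powRrM (K / _)).
by apply: ge0_ler_powR; rewrite ?nnegrE ?powR_ge0 ?invr_ge0 ?(ltW S0).
Qed.

Lemma meshE N j : (0 < N)%N -> mesh a b c d N j = a j `^ (b j)^-1 * rate N `^ (- (b j)^-1).
Proof.
move=> N0; rewrite /mesh hparE powRM ?invr_ge0 ?(ltW (ha j)) ?(ltW (rate_gt0 N N0))//.
by rewrite powRN -[(rate N)^-1]powR_inv1 ?(ltW (rate_gt0 N N0))// -powRrM mulN1r powRN.
Qed.

(** The power of [rate] carries [C_sharp] with exponent [D (1/b_j + 1/d_j) / (B + D)]; subtracting
    [1/d_j] gives [(D/b_j - B/d_j) / (B + D)]. *)
Lemma npointsE N j : (0 < N)%N -> npoints a b c d N j =
  Cst / Cj j * (rate N `^ ((b j)^-1 + (d j)^-1) * Csh `^ (- (d j)^-1)).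
Proof.
move=> N0; rewrite /npoints -mulrA; congr (_ * _).
have S0 := suminv_gt0; have C0 := Csharp_gt0.
rewrite /rate powRM ?powR_ge0// -!powRrM mulrC -mulrA -powRD; last first.
  by rewrite (gt_eqF C0) implybT.
congr (_ * _ `^ _); field.
by rewrite !gt_eqF.
Qed.

End parameters.

(** The lower bound on [X] is a quarter of [npoints] times the mesh size. The powers of [a] and
    [r^(1/b)] cancel, leaving [y] with [c y^d = (Cs / 2)^d r / Ch], which is at least [r] by the
    choice of [C_sharp]. *)
Lemma tail_exponent_ge (R : realType) (Cs Ch a b c d r X : R) :
  0 < Cs -> 0 < Ch -> 0 < a -> 0 < c -> 0 < d -> 0 < r -> Ch <= (Cs / 2) `^ d ->
  Cs / (c `^ d^-1 * a `^ b^-1 / 2) * (r `^ (b^-1 + d^-1) * Ch `^ (- d^-1)) / 4 *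
    (a `^ b^-1 * r `^ (- b^-1)) <= X ->
  r <= c * X `^ d.
Proof.
move=> Cs0 Ch0 a0 c0 d0 r0 Chd.
pose y := Cs / 2 * r `^ d^-1 * Ch `^ (- d^-1) * c `^ (- d^-1).
have -> : Cs / (c `^ d^-1 * a `^ b^-1 / 2) * (r `^ (b^-1 + d^-1) * Ch `^ (- d^-1)) / 4 *
    (a `^ b^-1 * r `^ (- b^-1)) = y.
  rewrite /y !powRN powRD; last by rewrite (gt_eqF r0) implybT.
  have := powR_gt0 b^-1 r0; have := powR_gt0 d^-1 r0.
  have := powR_gt0 d^-1 Ch0; have := powR_gt0 d^-1 c0; have := powR_gt0 b^-1 a0.
  move: (a `^ _) => ab; move: (c `^ _) => cd; move: (Ch `^ _) => Cd.
  move: (r `^ d^-1) => rd; move: (r `^ _) => rb ab0 cd0 Cd0 rd0 rb0.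
  by field; rewrite !gt_eqF.
have y0 : 0 <= y by rewrite !mulr_ge0 ?powR_ge0 ?invr_ge0 ?(ltW Cs0).
move=> yX; apply: le_trans (_ : c * y `^ d <= _); last first.
  rewrite ler_pM2l//; apply: ge0_ler_powR; rewrite ?nnegrE ?(ltW d0)//.
  exact: le_trans yX.
have dd : d^-1 * d = 1 by rewrite mulVf ?gt_eqF.
have E1 : (r `^ d^-1) `^ d = r by rewrite -powRrM dd powRr1 ?ltW.
have E2 (z : R) : 0 < z -> (z `^ (- d^-1)) `^ d = z^-1.
  by move=> z0; rewrite -powRrM mulNr dd powR_inv1 ?ltW.
have -> : y `^ d = (Cs / 2) `^ d * r / Ch / c.
  have Y1 : 0 <= Cs / 2 by rewrite divr_ge0 ?(ltW Cs0).
  have Y2 := mulr_ge0 Y1 (powR_ge0 r d^-1).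
  have Y3 := mulr_ge0 Y2 (powR_ge0 Ch (- d^-1)).
  rewrite /y (powRM _ Y3 (powR_ge0 _ _)) (powRM _ Y2 (powR_ge0 _ _)).
  by rewrite (powRM _ Y1 (powR_ge0 _ _)) E1 !E2.
by rewrite mulrC divfK ?gt_eqF// mulrAC ler_pMl// ler_pdivlMr// mul1r.
Qed.

Lemma powR_div_mesh (R : realType) (a b r k : R) : 0 < a -> 0 < b -> 0 < r -> 0 <= k ->
  a * `|k / (a `^ b^-1 * r `^ (- b^-1))| `^ b = k `^ b * r.
Proof.
move=> a0 b0 r0 k0.
have bb : b^-1 * b = 1 by rewrite mulVf ?gt_eqF.
have E1 : (r `^ b^-1) `^ b = r by rewrite -powRrM bb powRr1 ?ltW.
have E2 : (a `^ (- b^-1)) `^ b = a^-1 by rewrite -powRrM mulNr bb powR_inv1 ?ltW.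
have -> : k / (a `^ b^-1 * r `^ (- b^-1)) = k * a `^ (- b^-1) * r `^ b^-1.
  rewrite !powRN; have := powR_gt0 b^-1 r0; have := powR_gt0 b^-1 a0.
  move: (a `^ _) => x; move: (r `^ _) => y x0 y0.
  by field; rewrite !gt_eqF.
have K1 := mulr_ge0 k0 (powR_ge0 a (- b^-1)).
rewrite ger0_norm ?mulr_ge0 ?powR_ge0// (powRM _ K1 (powR_ge0 _ _)).
rewrite (powRM _ k0 (powR_ge0 _ _)) E1 E2; field.
by rewrite gt_eqF.
Qed.

Lemma powR_ge_of_root (R : realType) (K r e : R) : 0 <= K -> 0 < e -> 0 < r ->
  K `^ e^-1 <= r -> K <= r `^ e.
Proof.
move=> K0 e0 r0 Kr.
rewrite -[leLHS](powRr1 K0) -[X in _ `^ X <= _](@mulVf _ e) ?gt_eqF// (powRrM K).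
by apply: ge0_ler_powR; rewrite ?nnegrE ?powR_ge0 ?(ltW e0) ?(ltW r0).
Qed.

Section parameters_bounds.
Context (R : realType) (s : nat) (hs : (0 < s)%N) (a b c d : 'I_s -> R)
  (ha : forall j, 0 < a j) (hb : forall j, 0 < b j)
  (hc : forall j, 0 < c j) (hd : forall j, 1 <= d j).

Let d0 j : 0 < d j. Proof. exact: lt_le_trans ltr01 (hd j). Qed.
Let S0 : 0 < suminv b + suminv d. Proof. exact: suminv_gt0. Qed.
Let C0 j : 0 < Cc a b c d j. Proof. exact: Cc_gt0. Qed.
Let Cs0 : 0 < Cstar a b c d. Proof. exact: Cstar_gt0. Qed.
Let Ch0 : 0 < Csharp a b c d. Proof. exact: Csharp_gt0. Qed.

Lemma mesh_gt0 N j : (0 < N)%N -> 0 < mesh a b c d N j.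
Proof.
move=> N0; have r0 := rate_gt0 R s hs a b c d ha hc N N0.
by rewrite meshE// mulr_gt0 ?powR_gt0.
Qed.

(** In the product the exponents of [C_sharp] sum to [(D B - B D) / (B + D) = 0] and those of [N] to
    1, while each ratio [Cstar / Cc j] is at most 1. *)
Lemma prod_npoints_le N : (0 < N)%N -> \prod_j npoints a b c d N j <= N%:R.
Proof.
move=> N0; have NR : 0 < N%:R :> R by rewrite ltr0n.
rewrite /npoints !big_split /= !prod_powR// -!mulr_sumr sumrB -!mulr_sumr.
rewrite big_split /= -/(suminv b) -/(suminv d).
rewrite [suminv d * _]mulrC subrr mulr0 powRr0 mulVf ?gt_eqF// powRr1 ?(ltW NR)//.
rewrite mulr1 ler_piMl ?(ltW NR)//.
rewrite -big_split prodr_ile1//= => j _.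
rewrite mulr_ge0 ?invr_ge0 ?(ltW (C0 j)) ?(ltW Cs0)//=.
by rewrite ler_pdivrMr// mul1r Cstar_le.
Qed.

Lemma gexp_halfcell_mesh N j (m : nat) : (0 < N)%N ->
  npoints a b c d N j / 4 <= m%:R + 2^-1 ->
  gexp (c j) (d j) (halfcell (mesh a b c d N j) m) <= expR (- rate R s a b c d N).
Proof.
move=> N0 Pm; have r0 := rate_gt0 R s hs a b c d ha hc N N0.
have h0 := mesh_gt0 N j N0; have X0 := halfcell_ge0 R (mesh a b c d N j) m h0.
rewrite ler_expR lerN2 (ger0_norm X0).
apply: (tail_exponent_ge R (Cstar a b c d) (Csharp a b c d) (a j) (b j)) => //.
  exact: Csharp_le.
have := ler_wpM2r (ltW h0) Pm; apply: le_trans.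
by rewrite npointsE// meshE.
Qed.

(** Origin of the factor e in the constant: at frequency [k / h_j] the exponent is [k^b r], and
    [k^b r >= k^b + r - 1] for [k, r >= 1] separates [exp (1 - r)] from Euler's sum with unit
    parameters. *)
Lemma sum_gexp_mesh N j m : (0 < N)%N -> 1 <= rate R s a b c d N ->
  \sum_(k < m) gexp (a j) (b j) (k.+1%:R / mesh a b c d N j) <=
  expR 1 * expR (- rate R s a b c d N) * (Gammaf (b j)^-1 / b j).
Proof.
move=> N0; have r0 := rate_gt0 R s hs a b c d ha hc N N0.
set r := rate R s a b c d N in r0 * => r1.
have := sum_expR_powR_le_gamma R (b j) 1 1 m (hb j) ltr01 ltr01.
rewrite mul1r powR1 mulr1 => l.
apply: le_trans (_ : expR 1 * expR (- r) *
  \sum_(k < m) expR (- (1 * (k.+1%:R * 1) `^ b j)) <= _); last first.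
  by rewrite ler_pM2l ?mulr_gt0 ?expR_gt0.
rewrite mulr_sumr; apply: ler_sum => k _.
rewrite /gexp -!expRD ler_expR mul1r mulr1.
have k1 : 1 <= k.+1%:R `^ b j :> R.
  by rewrite -[leLHS](powRr0 k.+1%:R) ler_powR// ?ler1n// ltW.
rewrite meshE// powR_div_mesh// -/r.
move: k1 r1; move: (_ `^ _) => x x1 r1.
have : 0 <= (x - 1) * (r - 1) by rewrite mulr_ge0 ?subr_ge0.
lra.
Qed.

(** This absorbs the crude [3 h_j] of the truncation estimate into the term [a_j^(1/b_j)] of the
    constant. *)
Lemma mesh_small N j : (0 < N)%N -> 3 `^ b j <= rate R s a b c d N ->
  3 * mesh a b c d N j <= a j `^ (b j)^-1.
Proof.
move=> N0 r3; have r0 := rate_gt0 R s hs a b c d ha hc N N0.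
rewrite meshE// mulrCA ler_piMr ?powR_ge0// powRN ler_pdivrMr ?powR_gt0// mul1r.
by apply: powR_ge_of_root; rewrite ?invr_gt0// invrK.
Qed.

(** The required lower bound on [rate] is the value at which [npoints] equals 4, which is enough for
    the rounding of [n_j]. *)
Lemma npoints_large N j : (0 < N)%N ->
  (4 * Cc a b c d j * Csharp a b c d `^ (d j)^-1 / Cstar a b c d)
     `^ ((b j)^-1 + (d j)^-1)^-1 <= rate R s a b c d N ->
  4 <= npoints a b c d N j.
Proof.
move=> N0; have r0 := rate_gt0 R s hs a b c d ha hc N N0.
rewrite npointsE//; move: (rate R s a b c d N) r0 => r r0 rK.
set K := 4 * _ * _ / _ in rK.
set e := (b j)^-1 + (d j)^-1 in rK *; rewrite -/e in rK.
have e0 : 0 < e by rewrite addr_gt0 ?invr_gt0.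
have K0 : 0 <= K by rewrite !mulr_ge0 ?invr_ge0 ?powR_ge0 ?(ltW Cs0) ?(ltW (C0 j)).
have Kr : K <= r `^ e.
  exact: powR_ge_of_root.
apply: le_trans (_ : Cstar a b c d / Cc a b c d j * (K * Csharp a b c d `^ (- (d j)^-1)) <= _).
  rewrite le_eqVlt; apply/orP; left; apply/eqP; rewrite /K powRN.
  have := powR_gt0 (d j)^-1 Ch0; move: (_ `^ _) => u u0.
  by field; rewrite !gt_eqF.
apply: ler_wpM2l; first by rewrite divr_ge0 ?(ltW (C0 j)) ?(ltW Cs0).
by apply: ler_wpM2r => //; exact: powR_ge0.
Qed.

End parameters_bounds.

(** * Combining truncation and aliasing *)

Lemma gamma_ratio_ge0 (R : realType) (p c : R) : 0 < p -> 0 < c ->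
  0 <= Gammaf p^-1 / (p * c `^ p^-1).
Proof.
(* The comparison with the empty sum already contains the claim. *)
move=> p0 c0; have := sum_expR_powR_le_gamma R p c 1 0 p0 c0 ltr01.
by rewrite big_ord0 mulr0.
Qed.

(** With [G_i] the Gamma quotient, the factor of coordinate [j] is at most [2 q (A_j + 2 G_j)] and
    the others at most [A_i + 2 G_i], so all [s] summands share one bound. *)
Lemma sum_tail_factor_le (R : realType) s (c d h A : 'I_s -> R) (n : 'I_s -> nat) (q : R) :
  (forall j, 0 < c j) -> (forall j, 0 < d j) -> (forall j, 0 < h j) ->
  (forall j, 3 * h j <= A j) ->
  (forall j, gexp (c j) (d j) (halfcell (h j) (n j)./2) <= q) ->
  \sum_j \prod_i tail_factor c d h n j i <=
  2 * s%:R * q * \prod_j (A j + 2 * (Gammaf (d j)^-1 / (d j * c j `^ (d j)^-1))).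
Proof.
move=> c0 d0 h0 hA gq.
have G0 j := gamma_ratio_ge0 R (d j) (c j) (d0 j) (c0 j).
set P := \prod_j _.
rewrite (_ : 2 * s%:R * q * P = \sum_(j < s) (2 * q * P)); last first.
  by rewrite sumr_const card_ord -[RHS]mulr_natl; ring.
apply: ler_sum => j _; have -> : 2 * q * P = (2 * q * (A j +
   2 * (Gammaf (d j)^-1 / (d j * c j `^ (d j)^-1)))) * \prod_(i | i != j) (A i +
   2 * (Gammaf (d i)^-1 / (d i * c i `^ (d i)^-1))).
  by rewrite /P (bigD1 j)//=; exact: mulrA.
rewrite (bigD1 j)//=.
have := G0 j; have := hA j; have := h0 j => h0j hAj Gj.
apply: ler_pM.
- by rewrite /tail_factor eqxx !mulr_ge0 ?gexp_ge0// addr_ge0// ltW.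
- apply: prodr_ge0 => i /negbTE ij; rewrite /tail_factor ij.
  by rewrite addr_ge0// mulr_ge0// ltW.
- rewrite /tail_factor eqxx; apply: ler_pM; rewrite ?mulr_ge0 ?gexp_ge0//.
  + by rewrite addr_ge0// ltW.
  + by rewrite ler_pM2l.
  + by move: h0j hAj Gj; set G := _ / _; lra.
- apply: ler_prod => i /negbTE ij; rewrite /tail_factor ij; apply/andP; split.
    by apply: addr_ge0; apply: mulr_ge0 => //; exact: ltW.
  by rewrite lerD2r.
Qed.

(* The box reaches [P / 4] mesh sizes rather than [P / 2]: half of the cells are
   given up to the floor function. *)
Lemma npoints_bounds (R : realType) (P : R) (n : nat) : 4 <= P ->
  n%:Z + 1 = Num.max (Num.floor P) 1 -> n.+1%:R <= P /\ P / 4 <= (n./2)%:R + 2^-1.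
Proof.
move=> P4 nP.
have f4 : 4 <= Num.floor P by rewrite floor_ge_int.
have nE : Num.floor P = n.+1%:Z.
  by move: nP; rewrite max_l ?(le_trans _ f4)// -addn1 PoszD => ->.
have l1 : n.+1%:R <= P by have := floor_le P; rewrite nE.
have l2 : P < n.+2%:R by have := floorD1_gt P; rewrite nE intrD mulr1z natr1.
split => //.
have : n%:R <= 2 * (n./2)%:R + 1 :> R by rewrite -natrM natr1 ler_nat; lia.
move: l2; rewrite -[n.+2%:R]natr1 -[n.+1%:R]natr1; lra.
Qed.

Theorem theorem3 (R : realType) (s : nat) (hs : (0 < s)%N)
    (a b c d : 'I_s -> R)
    (ha : forall j, 0 < a j) (hb : forall j, 0 < b j)
    (hc : forall j, 0 < c j) (hd : forall j, 1 <= d j) :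
  exists N0 : nat, forall N : nat, (N0 <= N)%N ->
  forall n : 'I_s -> nat,
    (forall j, (n j)%:Z + 1 = Num.max (Num.floor (npoints a b c d N j)) 1) ->
    (forall f : 'rV[R]_s -> R, E_space (expweight c d) (expweight a b) f ->
      (`|Iint f - Qrule (mesh a b c d N) n f|%:E <=
       (Cs a b c d *
        expR (- (N%:R `^ (suminv b + suminv d)^-1 *
                 Csharp a b c d `^ (suminv d / (suminv b + suminv d)))))%:E *
       E_norm (expweight c d) (expweight a b) f)%E) /\
    (\prod_(j < s) (n j).+1 <= N)%N.
Proof.
have d0 j : 0 < d j by exact: lt_le_trans ltr01 (hd j).
(* [K1] is what [mesh_small] demands and [K2] what [npoints_large] demands. Their sums over [j]
   replace maxima, and the extra 2 in the threshold serves [eq1]. *)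
pose K1 j := 3 `^ b j.
pose K2 j := (4 * Cc a b c d j * Csharp a b c d `^ (d j)^-1 / Cstar a b c d)
     `^ ((b j)^-1 + (d j)^-1)^-1.
have K10 j : 0 <= K1 j by exact: powR_ge0.
have K20 j : 0 <= K2 j by exact: powR_ge0.
have sK1 : 0 <= \sum_j K1 j by apply: sumr_ge0.
have sK2 : 0 <= \sum_j K2 j by apply: sumr_ge0.
have [|N0 N0P] := rate_large R s hs a b c d ha hb hc hd (2 + \sum_j K1 j + \sum_j K2 j).
  by move: sK1 sK2; lra.
exists N0 => N /N0P[{N0P}N0' rK] n nP.
have r2 : 2 <= rate R s a b c d N by move: rK sK1 sK2; lra.
have rK1 j : K1 j <= rate R s a b c d N.
  have : K1 j <= \sum_j K1 j by rewrite (bigD1 j)//= lerDl sumr_ge0.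
  by move: rK sK2; lra.
have rK2 j : K2 j <= rate R s a b c d N.
  have : K2 j <= \sum_j K2 j by rewrite (bigD1 j)//= lerDl sumr_ge0.
  by move: rK sK1; lra.
have P4 j : 4 <= npoints a b c d N j by apply: npoints_large => //; exact: rK2.
have nb j := npoints_bounds R _ _ (P4 j) (nP j).
split; last first.
  rewrite -(ler_nat R); apply: le_trans (prod_npoints_le R s hs a b c d ha hb hc hd N N0').
  by rewrite natr_prod; apply: ler_prod => j _; rewrite ler0n (nb j).1.
move=> f fE.
have [B1 [B2 [B10 B20 -> fB1 fB2]]] := E_space_bounds R s a b c d f hb d0 fE.
have [cf fi _] := fE.
rewrite -/(rate R s a b c d N) -EFinM lee_fin.
set q := expR (- rate R s a b c d N).
have h0 j : 0 < mesh a b c d N j by exact: mesh_gt0.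
have r1 : 1 <= rate R s a b c d N by move: r2; lra.
have := trapezoidal_error R s a b c d (mesh a b c d N)
  (fun j => expR 1 * q * (Gammaf (b j)^-1 / b j)) n f B1 B2 hb hc hd h0 B10 B20 cf fi fB1 fB2
  (fun j m => sum_gexp_mesh R s hs a b c d ha hb hc N j m N0' r1).
have := sum_tail_factor_le R s c d (mesh a b c d N) (fun j => a j `^ (b j)^-1) n q hc d0 h0
  (fun j => mesh_small R s hs a b c d ha hb hc N j N0' (rK1 j))
  (fun j => gexp_halfcell_mesh R s hs a b c d ha hb hc hd N j (n j)./2 N0' (nb j).2).
have q0 : 0 < q by exact: expR_gt0.
have e0 : 0 < expR 1 :> R by exact: expR_gt0.
(* From [exp (r - 1) >= r >= 2]; it allows all powers of [2 e q] in the expanded aliasing product to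
   be bounded by the first. *)
have eq1 : 2 * expR 1 * q <= 1.
  rewrite -mulrA /q -expRD; have := expR_ge1Dx (rate R s a b c d N - 1).
  rewrite -[1 - _]opprB expRN => l; rewrite ler_pdivrMr ?expR_gt0// mul1r.
  by move: l r2; lra.
have G0 j : 0 <= Gammaf (b j)^-1 / b j.
  by have := gamma_ratio_ge0 R (b j) 1 (hb j) ltr01; rewrite powR1 mulr1.
have := alias_factor_le R s (2 * expR 1 * q) _ _ eq1 G0.
have Q0 : 0 <= 2 * expR 1 * q by rewrite !mulr_ge0 ?(ltW q0) ?(ltW e0).
rewrite [X in `|_ - Qrule _ _ _| <= X -> _](_ : _ =
  B2 * (\prod_j (1 + 2 * expR 1 * q * (Gammaf (b j)^-1 / b j)) - 1) +
  B1 * \sum_j \prod_i tail_factor c d (mesh a b c d N) n j i); last first.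
  by congr (_ * (_ - _) + _); apply: eq_bigr => j _; rewrite !mulrA.
rewrite /Cs.
move=> /(_ Q0).
set X := \prod_j (1 + _); set U := \sum_(u | _) _; set T := \sum_j _; set P := \prod_j _.
move=> hX hT hE; apply: le_trans hE _.
have U0 : 0 <= U by apply: sumr_ge0 => u _; apply: prodr_ge0.
have P0 : 0 <= P.
  apply: prodr_ge0 => j _; apply: addr_ge0; first exact: powR_ge0.
  by rewrite mulr_ge0// gamma_ratio_ge0.
have u0 : 0 <= expR 1 * q * U by rewrite !mulr_ge0 ?(ltW q0) ?(ltW e0).
have p0 : 0 <= s%:R * q * P by rewrite !mulr_ge0 ?(ltW q0).
(* Aliasing comes with [B2] and truncation with [B1], each with constant 2; replacing both by
   [B1 + B2] adds nonnegative terms only, well within the constant 4. *)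
have hXB := ler_wpM2l B20 hX; have hTB := ler_wpM2l B10 hT.
have := mulr_ge0 B10 u0; have := mulr_ge0 B20 u0.
have := mulr_ge0 B10 p0; have := mulr_ge0 B20 p0.
by move: hXB hTB; lra.
Qed.
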